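(* Let $T\ge1$, let $\{f_n\}_{n\ge1}$ and $\{g_n\}_{n\ge1}$ be sequences of probability densities that are periodic with period $T$ ($f_{n+T}=f_n$, $g_{n+T}=g_n$ for all $n\ge 1$), and let $$I=\frac1T\sum_{i=1}^T D(g_i\,\|\,f_i)$$ satisfy $0<I<\infty$. Let $$W_{n} = \max_{1 \leq k \leq n} \sum_{i=k}^{n} \log \frac{g_{i}(X_{i})}{f_{i}(X_{i})},\qquad \tau_c=\inf\{n\ge1: W_n>A\}.$$ Then the stopping time $\tau_c$ with $A=\log\beta$ satisfies the false alarm constraint $$\mathsf{E}_\infty[\tau_c]\ge\beta,$$ and as $\beta\to\infty$, $$\sup_{\nu\geq 1} \mathsf{E}_\nu [\tau_c - \nu \mid \tau_c \geq \nu] \;\leq\; \sup_{\nu\geq 1} \, \operatorname{ess\,sup}\, \mathsf{E}_\nu [\tau_c - \nu \mid X_1, \cdots, X_{\nu-1}] \;\leq\; \frac{A}{I} (1 + o(1)) = \frac{\log \beta}{I} (1 + o(1)).$$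
   Context: Change point model: for $\nu\ge 1$, $\mathsf{P}_\nu$ denotes the law of the process $\{X_n\}_{n\ge1}$ of independent random variables such that $X_n$ has density $f_n$ for $n<\nu$ and density $g_n$ for $n\ge\nu$ (change at time $\nu$), with corresponding expectation $\mathsf{E}_\nu$. $\mathsf{P}_\infty,\mathsf{E}_\infty$ correspond to no change ($X_n\sim f_n$ for all $n$). The stopping time $\tau_c$ is called the Periodic-CUSUM stopping time; equivalently $W_{n+1}=\max\{W_n,0\}+\log\frac{g_{n+1}(X_{n+1})}{f_{n+1}(X_{n+1})}$. $D(g\,\|\,f)$ is the Kullback-Leibler divergence between densities $g$ and $f$, i.e. $\int g\log(g/f)$. It is assumed that $D(g_i\,\|\,f_i)<\infty$ for all $i=1,\dots,T$ and $D(g_i\,\|\,f_i)>0$ for some $i$. The essential supremum $\operatorname{ess\,sup}$ of $\mathsf{E}_\nu[\tau-\nu\mid X_1,\dots,X_{\nu-1}]$ is its supremum as a random variable outside a set of $\mathsf{P}_\nu$-measure zero. Conditional expectations given $\{\tau_c\ge\nu\}$ are considered only for those $\nu$ for which this event has positive probability. An $o(1)$ term is one that goes to zero as $\beta\to\infty$. *)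

(* Defs.v *)
From HB Require Import structures.
From mathcomp Require Export all_boot all_order all_algebra.
From mathcomp Require Export all_classical all_reals all_analysis.
From mathcomp Require Export measurable_realfun ess_sup_inf.
Export Order.TTheory GRing.Theory Num.Theory.
Export numFieldNormedType.Exports.

Set Implicit Arguments.
Unset Strict Implicit.
Unset Printing Implicit Defensive.

Local Open Scope classical_set_scope.
Local Open Scope ring_scope.
Local Open Scope ereal_scope.

(* All sequences (X_n), (f_n), (g_n), (P_nu), (W_n) are indexed by n >= 1; the
   term of index 0 is never constrained nor used. *)

Section densities.
Context {d : measure_display} {E : measurableType d} {R : realType}.
Implicit Types (mu : {measure set E -> \bar R}) (f g : E -> R).

Definition is_density mu f : Prop :=
  [/\ measurable_fun [set: E] f, (forall x, (0 <= f x)%R) &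
      \int[mu]_x (f x)%:E = 1].

(* Extended-real valued: -oo where g = 0 < f and +oo where f = 0 < g. At points
   where f = g = 0 it is -oo by 0 * +oo = 0. *)
Definition log_ratio f g (x : E) : \bar R := lne ((g x)%:E / (f x)%:E).

(* D(g || f); the convention 0 * log 0 = 0 is that of the product in \bar R. *)
Definition kl_divergence mu g f : \bar R :=
  \int[mu]_x ((g x)%:E * log_ratio f g x).

Definition mean_divergence mu (T : nat) (f g : nat -> E -> R) : \bar R :=
  (T%:R^-1)%:E * \sum_(1 <= i < T.+1) kl_divergence mu (g i) (f i).

End densities.

Section processes.
Context {d d' : measure_display} {Omega : measurableType d}.
Context {E : measurableType d'} {R : realType}.
Implicit Types (P : probability Omega R) (mu : {measure set E -> \bar R}).
Implicit Types (X : nat -> {mfun Omega >-> E}) (f g h : nat -> E -> R).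

Definition mutually_independent P X : Prop :=
  forall s : seq nat, uniq s -> all (leq 1) s ->
  forall B : nat -> set E, (forall i, measurable (B i)) ->
    P (\bigcap_(i in [set` s]) (X i @^-1` B i)) =
    \prod_(i <- s) P (X i @^-1` B i).

Definition has_density P mu (Y : Omega -> E) (h : E -> R) : Prop :=
  forall B, measurable B -> P (Y @^-1` B) = \int[mu]_(x in B) (h x)%:E.

Definition independent_densities P mu X h : Prop :=
  mutually_independent P X /\
  forall n, (1 <= n)%N -> has_density P mu (X n) (h n).

Definition no_change_law P mu X f : Prop := independent_densities P mu X f.

Definition change_law P mu X f g (nu : nat) : Prop :=
  independent_densities P mu X (fun n => if (n < nu)%N then f n else g n).

Definition cusum X f g (n : nat) (w : Omega) : \bar R :=
  \big[maxe/-oo]_(1 <= k < n.+1)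
    \sum_(k <= i < n.+1) log_ratio (f i) (g i) (X i w).

(* The infimum of the empty set is +oo. *)
Definition cusum_time X f g (A : R) (w : Omega) : \bar R :=
  ereal_inf [set n%:R%:E | n in [set n : nat |
    (1 <= n)%N /\ A%:E < cusum X f g n w]].

(* The sigma-algebra generated by X_1, ..., X_(nu - 1). *)
Definition past X (nu : nat) : set (set Omega) :=
  <<s \bigcup_(i in [set i | (1 <= i < nu)%N])
        preimage_set_system [set: Omega] (X i) measurable >>.

End processes.

Section conditioning.
Context {d : measure_display} {Omega : measurableType d} {R : realType}.
Implicit Types (P : probability Omega R) (Y Z : Omega -> \bar R).

Definition cond_mean_event P (B : set Omega) Z : \bar R :=
  (\int[P]_(w in B) Z w) / P B.

(* Y is a version of the conditional expectation of Z given the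
   sub-sigma-algebra G. *)
Definition is_cond_expectation P (G : set (set Omega)) Z Y : Prop :=
  (forall B : set (\bar R), measurable B -> G (Y @^-1` B)) /\
  (forall B, G B -> \int[P]_(w in B) Y w = \int[P]_(w in B) Z w).

(* A version chosen among all of them; only defined up to a null set. *)
Definition cond_expectation P (G : set (set Omega)) Z : Omega -> \bar R :=
  xget (cst 0) [set Y | is_cond_expectation P G Z Y].

End conditioning.

Section delays.
Context {d d' : measure_display} {Omega : measurableType d}.
Context {E : measurableType d'} {R : realType}.
Variables (P : nat -> probability Omega R) (X : nat -> {mfun Omega >-> E}).
Variable tau : Omega -> \bar R.

Let delay (nu : nat) (w : Omega) : \bar R := tau w - nu%:R%:E.

(* sup_(nu >= 1) E_nu[tau - nu | tau >= nu], over the nu for which the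
   conditioning event has positive probability. *)
Definition cond_average_delay : \bar R :=
  ereal_sup [set cond_mean_event (P nu) [set w | nu%:R%:E <= tau w] (delay nu)
    | nu in [set nu : nat |
        (1 <= nu)%N /\ 0 < P nu [set w | nu%:R%:E <= tau w]]].

(* sup_(nu >= 1) ess sup E_nu[tau - nu | X_1, ..., X_(nu - 1)] *)
Definition worst_average_delay : \bar R :=
  ereal_sup [set ess_sup (P nu) (cond_expectation (P nu) (past X nu) (delay nu))
    | nu in [set nu : nat | (1 <= nu)%N]].

End delays.

(* Main.v *)
From HB Require Import structures.
Require Import Defs.
From mathcomp Require Import ring lra.

(** False alarms.  Write L_n for the likelihood ratio of the n-th observation
    and R_n for the sum over k <= n of L_k * ... * L_n, so that
    R_n = (R_(n-1) + 1) L_n and exp W_n <= R_n.  Without a change each L_n has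
    mean at most 1 and is independent of the past, hence R_n - n is a
    supermartingale.  Stopped at the CUSUM time tau, where R exceeds beta, this
    says beta * P(tau <= n) <= E[min(tau, n)]
    ([shiryaev_roberts_telescope]).  Either tau is infinite with positive
    probability and its mean is infinite, or P(tau <= n) tends to 1; in both
    cases E[tau] >= beta ([expected_cusum_time_ge]).

    Delay.  After a change at nu, an alarm is raised at the latest when the
    random walk of the log-likelihood ratios started at nu exceeds the
    threshold A.  Cut the steps of that walk at a level M.  When the cut walk
    first exceeds A it is at most A + M, and by Wald's argument its mean there
    is the sum of the drifts of the steps, each weighted by the probability
    that the step is taken ([stopped_drift_le]).  The drifts are periodic with
    mean J, and the weights are nonincreasing, so by summation by parts every
    drift may be replaced by J at the cost of a constant ([abel_sum_ge],
    [sum_periodic_ge]).  The mean delay is therefore at most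
    (A + M + T (1 + J)) / J ([sum_below_le]).  By monotone convergence J tends
    to I as M grows ([cvg_mean_drift]), which gives the asymptotic bound.

    Conditioning.  All these inequalities are integrated over an arbitrary event
    B of the past before the change, which only requires that each observation
    be independent of the previous ones.  The bound K * P(B) on the integral of
    the delay over all such B is a bound by K on the essential supremum of any
    version of the conditional expectation ([ess_sup_version_le]); a version
    exists by the Radon-Nikodym theorem because the delay is integrable
    ([cond_expectation_exists]).  Finally {tau >= nu} is itself an event of the
    past, so the mean of the delay given that event is an average of the
    conditional expectation ([cond_mean_event_le_ess_sup]). *)

Set Implicit Arguments.
Unset Strict Implicit.
Unset Printing Implicit Defensive.

Local Open Scope classical_set_scope.
Local Open Scope ring_scope.

(** * Partial sums weighted by a nonincreasing sequence *)

(** Summation by parts: the weighted sum is a combination with nonnegative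
    coefficients q_i - q_(i+1) of the partial sums of D.  The induction carries
    the boundary term along. *)
Lemma abel_sum_ge (R : realType) (D q : nat -> R) (C : R) :
  (forall m, - C <= \sum_(0 <= i < m) D i) ->
  (forall n, 0 <= q n) -> (forall n, q n.+1 <= q n) ->
  forall n, - (C * q 0%N) <= \sum_(0 <= i < n) D i * q i.
Proof.
move=> DC q0 qS [|n].
  have := DC 0%N; rewrite !big_geq// => C0.
  by rewrite -mulNr mulr_le0_ge0.
suff : (\sum_(0 <= i < n.+1) D i + C) * q n - C * q 0%N <=
    \sum_(0 <= i < n.+1) D i * q i.
  apply: le_trans; rewrite -[leLHS]add0r lerD2r mulr_ge0//.
  by rewrite -lerBlDr sub0r.
elim: n => [|n IH]; first by rewrite !big_nat1 mulrDl addrK.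
rewrite big_nat_recr//= [leRHS]big_nat_recr//=.
set F := \sum_(0 <= i < n.+1) D i in IH *.
apply: (@le_trans _ _ ((F + C) * q n - C * q 0%N + D n.+1 * q n.+1)).
  have : (F + C) * q n.+1 <= (F + C) * q n.
    by apply: ler_wpM2l => //; rewrite -lerBlDr sub0r; exact: DC.
  by rewrite !mulrDl; lra.
by rewrite lerD2r.
Qed.

Section periodic_sums.
Context (R : realType) (T : nat) (D : nat -> R).
Hypothesis D_periodic : forall i, D (i + T)%N = D i.

Lemma sum_period_shift s :
  \sum_(0 <= i < T) D (s + i)%N = \sum_(0 <= i < T) D i.
Proof.
elim: s => [|s IH]; first by apply: eq_big_nat.
rewrite -IH; have [->|T0] := posnP T; first by rewrite !big_geq.
apply/eqP; rewrite -(inj_eq (addrI (D s))); apply/eqP.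
transitivity (\sum_(0 <= i < T.+1) D (s + i)%N).
  rewrite big_nat_recl// addn0; congr (_ + _).
  by apply: eq_big_nat => i _; rewrite addnS.
by rewrite big_nat_recr//= D_periodic addrC.
Qed.

(** Whole periods contribute nothing, so only fewer than T terms remain. *)
Lemma sum_periodic_ge (c : R) : (0 < T)%N -> 0 <= c ->
  \sum_(0 <= i < T) D i = 0 -> (forall i, - c <= D i) ->
  forall m, - (T%:R * c) <= \sum_(0 <= i < m) D i.
Proof.
move=> T0 c0 sumD0 Dc m; rewrite (divn_eq m T).
elim: (m %/ T)%N => [|k IH].
  rewrite mul0n add0n.
  apply: (@le_trans _ _ (\sum_(0 <= i < m %% T) - c)).
    rewrite sumr_const_nat subn0 mulNrn lerN2 -[leLHS]mulr_natl.
    by rewrite ler_wpM2r// ler_nat ltnW// ltn_mod.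
  by apply: ler_sum => i _.
rewrite mulSn -addnA (big_cat_nat (n := T)) ?leq_addr//= sumD0 add0r.
rewrite -[X in index_iota X _](add0n T) big_addn addKn.
by rewrite (eq_big_nat _ _ (F2 := D)).
Qed.

End periodic_sums.

Local Open Scope ereal_scope.

(** * Integrals against image measures and densities *)

Section integral_transfer.
Import HBNNSimple.

(** Change of variables and change of density in one statement, proved first
    for simple functions.  It is used with q the identity (density of a
    measure), with q an observation and phi the indicator of a past event, and
    with q a past random variable and phi a function of the next observation
    (product rule for expectations of independent variables). *)
Lemma ge0_integral_transfer d1 d2 (T1 : measurableType d1)
    (T2 : measurableType d2) (R : realType) (mu : {measure set T1 -> \bar R})
    (m : {measure set T2 -> \bar R}) (q : T1 -> T2) (phi : T1 -> \bar R)
    (h : T2 -> \bar R) :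
  measurable_fun setT q -> measurable_fun setT phi ->
  (forall x, 0 <= phi x) ->
  (forall B, measurable B -> m B = \int[mu]_(x in q @^-1` B) phi x) ->
  measurable_fun setT h -> (forall y, 0 <= h y) ->
  \int[m]_y h y = \int[mu]_x (h (q x) * phi x).
Proof.
move=> mq mphi phi0 mE mh h0.
have mqI B : measurable B -> measurable (q @^-1` B).
  by move=> mB; rewrite -[_ @^-1` _]setTI; exact: mq.
pose f_ := nnsfun_approx measurableT mh.
have cvgf y : EFin \o f_^~ y @ \oo --> h y.
  by apply: cvg_nnsfun_approx => // *; exact: h0.
have mf n : measurable_fun setT (EFin \o f_ n).
  exact/measurable_EFinP/measurable_funP.
have ndf y : {homo (fun n => (f_ n y)%:E) : a b / (a <= b)%N >-> a <= b}.
  by move=> a b ab; rewrite lee_fin; exact/lefP/nd_nnsfun_approx.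
have simpleE (s : {nnsfun T2 >-> R}) :
    \int[m]_y (s y)%:E = \int[mu]_x ((s (q x))%:E * phi x).
  have mind r : measurable_fun setT (fun x => \1_(s @^-1` [set r]) (q x) : R).
    by apply: measurableT_comp => //; exact: measurable_indic.
  rewrite integralT_nnsfun sintegralE.
  transitivity (\sum_(r \in range s)
      \int[mu]_x (r%:E * ((\1_(s @^-1` [set r]) (q x))%:E * phi x))).
    apply: eq_fsbigr => r /[!inE] -[y _ <-].
    rewrite ge0_integralZl//; last 3 first.
    - apply: emeasurable_funM => //; exact/measurable_EFinP.
    - by move=> x _; apply: mule_ge0 => //; rewrite lee_fin.
    - by rewrite lee_fin.
    rewrite mE// integral_mkcond; congr (_ * _).
    apply: eq_integral => x _; rewrite /patch indicE.
    rewrite (_ : (x \in _) = (q x \in s @^-1` [set s y])); last first.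
      by apply/idP/idP; rewrite !inE.
    by case: ifP => _; rewrite ?mul1e// mul0e.
  rewrite -ge0_integral_fsum//; last 2 first.
  - move=> r; apply: measurable_funeM; apply: emeasurable_funM => //.
    exact/measurable_EFinP.
  - move=> r x _; rewrite muleA; apply: mule_ge0 => //.
    rewrite -EFinM lee_fin; exact: nnfun_muleindic_ge0.
  apply: eq_integral => x _.
  rewrite fimfunE -fsumEFin// ge0_mule_fsuml; last first.
    by move=> r; rewrite lee_fin; exact: nnfun_muleindic_ge0.
  by apply: eq_fsbigr => r _; rewrite muleA EFinM.
transitivity (limn (fun n => \int[m]_y (f_ n y)%:E)).
  rewrite -monotone_convergence//; last by move=> n y _; rewrite lee_fin.
  by apply: eq_integral => y _; apply/esym/cvg_lim => //; exact: cvgf.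
under eq_fun do rewrite simpleE.
rewrite -monotone_convergence//; last 3 first.
- move=> n; apply: emeasurable_funM => //.
  exact: (measurableT_comp (mf n)).
- by move=> n x _; apply: mule_ge0 => //; rewrite lee_fin.
- by move=> x _ a b ab; apply: lee_wpmul2r => //; exact: ndf.
apply: eq_integral => x _; apply/cvg_lim => //.
have [phifin|] := boolP (phi x \is a fin_num).
  by apply: cvgeZr => //; exact: cvgf.
rewrite ge0_fin_numE// -leNgt leye_eq => /eqP ->.
have hE : h (q x) = ereal_sup (range (fun n => (f_ n (q x))%:E)).
  apply: (cvg_unique _ (cvgf (q x))) => //.
  exact/ereal_nondecreasing_cvgn/ndf.
have [hx0|hx0] := eqVneq (h (q x)) 0.
  rewrite hx0 mul0e; apply: cvg_near_cst; apply: nearW => n /=.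
  rewrite (_ : (f_ n (q x))%:E = 0) ?mul0e//; apply/eqP.
  rewrite eq_le -{1}hx0 lee_fin fun_ge0 andbT hE.
  by apply: ereal_sup_ubound; exists n.
have {}hx0 : 0 < h (q x) by rewrite lt_def hx0 h0.
rewrite gt0_muley//; apply: cvg_near_cst.
move: hx0; rewrite hE => /ereal_sup_gt[_ [n0 _ <-] fn0].
near=> n; apply: gt0_muley; apply: lt_le_trans fn0 _; apply: ndf.
by near: n; exists n0.
Unshelve. all: by end_near. Qed.

End integral_transfer.

(** * The past of an independent sequence *)

Definition past_generator d d' (Omega : measurableType d)
    (E : measurableType d') (X : nat -> {mfun Omega >-> E}) (nu : nat) :
    set (set Omega) :=
  \bigcup_(i in [set i | (1 <= i < nu)%N])
    preimage_set_system [set: Omega] (X i) measurable.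

(** The sample space with the sigma-algebra of the past as its measurable sets,
    so that measurability with respect to the past can be proved with the
    general lemmas on measurable functions. *)
Definition pastType d d' (Omega : measurableType d)
    (E : measurableType d') (X : nat -> {mfun Omega >-> E}) (nu : nat) :=
  g_sigma_algebraType (past_generator X nu).

Section past_theory.
Context d d' (Omega : measurableType d) (E : measurableType d').
Variables (X : nat -> {mfun Omega >-> E}).

Lemma past_measurable nu B : past X nu B -> measurable B.
Proof.
apply: smallest_sub; first exact: sigma_algebra_measurable.
by move=> _ [i _ [C mC <-]]; apply: measurable_funPT => //; exact: mC.
Qed.

Lemma measurable_past_X nu i : (1 <= i < nu)%N ->
  measurable_fun [set: pastType X nu] (X i : pastType X nu -> E).
Proof.
by move=> inu _ B mB; apply: sub_gen_smallest; exists i => //; exists B.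
Qed.

Lemma past_measurable_fun d2 (T : measurableType d2) nu
    (Y : Omega -> T) :
  measurable_fun [set: pastType X nu] (Y : pastType X nu -> T) ->
  measurable_fun [set: Omega] Y.
Proof. by move=> mY _ B mB; apply: (@past_measurable nu); exact: mY. Qed.

Lemma pastS m n : (m <= n)%N -> past X m `<=` past X n.
Proof.
move=> mn A; apply: smallest_sub; first exact: smallest_sigma_algebra.
move=> {}A [i /= /andP[i1 im] iA]; apply: sub_gen_smallest.
by exists i => //=; rewrite i1 (leq_trans im mn).
Qed.

End past_theory.

Section independence.
Context d d' (Omega : measurableType d) (E : measurableType d').
Context (R : realType).
Variables (X : nat -> {mfun Omega >-> E}) (P : probability Omega R).
Hypothesis Xind : mutually_independent P X.

Let box n : set (set Omega) := [set A | exists2 D : nat -> set E,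
  (forall i, measurable (D i)) &
  A = \bigcap_(i in [set` iota 1 n]) (X i @^-1` D i)].

(** The finite intersections of events about single past observations form a
    pi-system that generates the past, and the events that satisfy the product
    rule form a Dynkin system. *)
Lemma past_independent n B C : past X n.+1 B -> measurable C ->
  P (B `&` X n.+1 @^-1` C) = P B * P (X n.+1 @^-1` C).
Proof.
move=> pB mC.
have mXC i D : measurable D -> measurable (X i @^-1` D).
  by move=> mD; rewrite -[_ @^-1` _]setTI; exact: measurable_funPT.
have boxI : setI_closed (box n).
  move=> _ _ [D mD ->] [D' mD' ->]; exists (fun i => D i `&` D' i).
    by move=> i; exact: measurableI.
  by rewrite -bigcapI.
have box_meas A : box n A -> measurable A.
  move=> [D mD ->]; rewrite bigcap_seq; apply: bigsetI_measurable => i _.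
  exact: mXC.
have sbox A : <<s box n>> A -> measurable A.
  by apply: smallest_sub => //; exact: sigma_algebra_measurable.
have : <<s box n>> B.
  move: pB; apply: smallest_sub; first exact: smallest_sigma_algebra.
  move=> _ [i /= /andP[i1 ni] [D mD <-]]; apply: sub_gen_smallest.
  exists (fun j => if j == i then D else setT) => [j|]; first by case: ifP.
  rewrite setTI; apply/seteqP; split => w /=.
    by move=> XD j _ /=; case: eqP => [->|].
  by move=> /(_ i); rewrite /= eqxx; apply; rewrite mem_iota i1 add1n.
pose XC := X n.+1 @^-1` C; have mXCn : measurable XC by exact: mXC.
have indepC (S : set Omega) : measurable S ->
    P (S `&` XC) = P S * P XC -> P (~` S `&` XC) = P (~` S) * P XC.
  move=> mS IH.
  rewrite setIC -setDE probability_setC// measureD//; last first.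
    by rewrite ltey_eq fin_num_measure.
  rewrite muleBl ?mul1e; last 2 first.
  - by rewrite fin_num_measure.
  - by rewrite fin_num_adde_defl// fin_numN fin_num_measure.
  by congr (_ - _); rewrite setIC; exact: IH.
have indepU (F : (set Omega)^nat) : (forall k, measurable (F k)) ->
    trivIset [set: nat] F -> (forall k, P (F k `&` XC) = P (F k) * P XC) ->
    P (\bigcup_k F k `&` XC) = P (\bigcup_k F k) * P XC.
  move=> mF tF IH.
  rewrite setI_bigcupl !measure_bigcup//; last 2 first.
  - by move=> i _; exact: measurableI.
  - by apply: trivIset_setIr.
  transitivity (\sum_(0 <= i <oo | i \in [set: nat])
      ((fine (P XC))%:E * P (F i))).
    apply: eq_eseriesr => i _; rewrite fineK ?fin_num_measure// muleC.
    exact: IH.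
  by rewrite nneseriesZl// fineK ?fin_num_measure// muleC.
move: {pB} B.
apply: (@dynkin_induction _ (g_sigma_algebraType (box n)) (box n)
   [set B | P (B `&` X n.+1 @^-1` C) = P B * P (X n.+1 @^-1` C)]) => //=.
- by rewrite setTI probability_setT mul1e.
- move=> _ [D mD ->] /=.
  pose D' i := if i == n.+1 then C else D i.
  have uiota : uniq (iota 1 n.+1) by exact: iota_uniq.
  have aiota k : all (leq 1) (iota 1 k).
    by apply/allP => i; rewrite mem_iota => /andP[].
  have D'E i : i \in iota 1 n -> D' i = D i.
    rewrite mem_iota add1n ltnS /D' => /andP[_].
    by case: eqP => // ->; rewrite ltnn.
  rewrite (Xind (iota_uniq 1 n) (aiota n) mD).
  have iotaE : iota 1 n.+1 = iota 1 n ++ [:: n.+1].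
    by rewrite -[in LHS](addn1 n) iotaD add1n.
  have mD' i : measurable (D' i) by rewrite /D'; case: ifP.
  have := Xind uiota (aiota n.+1) mD'.
  rewrite iotaE big_cat/= big_seq1 [in X in _ * X]/D' eqxx.
  rewrite (eq_big_seq (fun i => P (X i @^-1` D i))); last first.
    by move=> i /D'E ->.
  move=> <-.
  congr (P _); apply/seteqP; split => [w [wD wC] i|w wD'] /=.
    rewrite mem_cat inE => /orP[iin|/eqP ->]; last by rewrite /D' eqxx.
    by rewrite D'E//; exact: wD.
  split.
    move=> i /= iin; rewrite -(D'E i iin); apply: wD'.
    by rewrite /= mem_cat iin.
  have := wD' n.+1; rewrite /= /D' eqxx; apply.
  by rewrite mem_cat inE eqxx orbT.
- by move=> S mS; apply: indepC; exact: sbox.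
- by move=> F mF tF IH; exact: (indepU F (fun k => sbox _ (mF k)) tF IH).
Qed.

Lemma ge0_integral_past_indic n B (h : E -> \bar R) :
  past X n.+1 B -> measurable_fun setT h -> (forall x, 0 <= h x) ->
  \int[P]_w (h (X n.+1 w) * (\1_B w)%:E) = \int[P]_w h (X n.+1 w) * P B.
Proof.
move=> pB mh h0.
have mB := past_measurable pB.
have PBfin : P B \is a fin_num by exact: fin_num_measure.
have PB0 : (0 <= fine (P B))%R by exact: fine_ge0.
rewrite -(@ge0_integral_transfer _ _ _ _ _ P
  (mscale (NngNum PB0) (pushforward P (X n.+1))) (X n.+1))//.
- by rewrite ge0_integral_mscale// ge0_integral_pushforward//= fineK// muleC.
- exact/measurable_EFinP/measurable_indic.
- move=> C mC.
  change ((fine (P B))%:E * P (X n.+1 @^-1` C) =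
    \int[P]_(x in X n.+1 @^-1` C) (\1_B x)%:E).
  rewrite fineK// -past_independent//.
  rewrite integral_indic//.
  by rewrite -[_ @^-1` _]setTI; exact: measurable_funPT.
Qed.

Lemma ge0_integral_past_prod n (Z : Omega -> \bar R) (h : E -> \bar R) :
  measurable_fun [set: pastType X n.+1] (Z : pastType X n.+1 -> \bar R) ->
  (forall w, 0 <= Z w) ->
  measurable_fun setT h -> (forall x, 0 <= h x) ->
  \int[P]_w h (X n.+1 w) < +oo ->
  \int[P]_w (Z w * h (X n.+1 w)) = \int[P]_w Z w * \int[P]_w h (X n.+1 w).
Proof.
move=> pZ Z0 mh h0 hoo.
have mZ := past_measurable_fun pZ.
have c0 : 0 <= \int[P]_w h (X n.+1 w) by exact: integral_ge0.
have cfin : \int[P]_w h (X n.+1 w) \is a fin_num by rewrite ge0_fin_numE.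
have c0' : (0 <= fine (\int[P]_w h (X n.+1 w)))%R by exact: fine_ge0.
transitivity (\int[P]_w (`|Z w| * h (X n.+1 w))).
  by apply: eq_integral => w _; rewrite gee0_abs.
rewrite -(@ge0_integral_transfer _ _ _ _ _ P
  (mscale (NngNum c0') (pushforward P Z)) Z (h \o X n.+1) abse)//.
- rewrite ge0_integral_mscale// ge0_integral_pushforward//= fineK// muleC.
  by congr (_ * _); apply: eq_integral => w _ /=; rewrite gee0_abs.
- exact: measurableT_comp.
- by move=> w /=.
- move=> C mC.
  change ((fine (\int[P]_w h (X n.+1 w)))%:E * P (Z @^-1` C) =
    \int[P]_(x in Z @^-1` C) h (X n.+1 x)).
  rewrite fineK//.
  rewrite -ge0_integral_past_indic//; last first.
    by rewrite -[_ @^-1` _]setTI; exact: pZ.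
  rewrite [RHS]integral_mkcond; apply: eq_integral => w _.
  by rewrite /patch indicE/=; case: ifP => _; rewrite ?mule1// mule0.
Qed.

Lemma ge0_integral_density (mu : {measure set E -> \bar R}) n (k : E -> R)
    (h : E -> \bar R) :
  has_density P mu (X n) k -> measurable_fun setT k -> (forall x, 0 <= k x)%R ->
  measurable_fun setT h -> (forall x, 0 <= h x) ->
  \int[P]_w h (X n w) = \int[mu]_x (h x * (k x)%:E).
Proof.
move=> hk mk k0 mh h0.
rewrite -(@ge0_integral_transfer _ _ _ _ _ mu (pushforward P (X n)) idfun)//.
- by rewrite ge0_integral_pushforward.
- exact: measurable_id.
- exact/measurable_EFinP.
Qed.

End independence.

(** * The stopping time as a sum of survival indicators *)

Lemma emeasurable_big d (T : measurableType d) (R : realType) (I : eqType)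
    (op : \bar R -> \bar R -> \bar R) (idx : \bar R) (s : seq I)
    (h : I -> T -> \bar R) :
  (forall u v : T -> \bar R, measurable_fun setT u -> measurable_fun setT v ->
    measurable_fun setT (fun x => op (u x) (v x))) ->
  (forall i, i \in s -> measurable_fun setT (h i)) ->
  measurable_fun setT (fun x => \big[op/idx]_(i <- s) h i x).
Proof.
move=> mop; elim: s => [|i s IH] mh.
  by under eq_fun do rewrite big_nil; exact: measurable_cst.
under eq_fun do rewrite big_cons.
apply: mop; first by apply: mh; rewrite mem_head.
by apply: IH => j js; apply: mh; rewrite inE js orbT.
Qed.

(** Clearing the denominator handles the points where f or g vanishes, whence
    measurability of the log-likelihood ratio. *)
Lemma lte_log_ratio d (E : measurableType d) (R : realType) (f g : E -> R)
    (a : R) x : (0 <= f x)%R -> (0 <= g x)%R ->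
  (a%:E < log_ratio f g x) = ((expR a * f x)%:E < (g x)%:E).
Proof.
move=> f0 g0; rewrite /log_ratio -lte_expeR lneK; last first.
  by rewrite in_itv/= leey andbT mule_ge0// ?inve_ge0 ?lee_fin.
have [fx0|fx0] := eqVneq (f x) 0%R.
  rewrite fx0 mulr0 inve0; have [gx0|gx0] := eqVneq (g x) 0%R.
    by rewrite gx0 mul0e ltxx /= lte_fin ltNge expR_ge0.
  rewrite gt0_muley; first by rewrite ltry !lte_fin lt_def gx0 g0.
  by rewrite lte_fin lt_def gx0.
rewrite inver (negbTE fx0) /= -EFinM !lte_fin ltr_pdivlMr//.
by rewrite lt_def fx0.
Qed.

Lemma measurable_log_ratio d (E : measurableType d) (R : realType)
    (f g : E -> R) :
  measurable_fun setT f -> (forall x, 0 <= f x)%R ->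
  measurable_fun setT g -> (forall x, 0 <= g x)%R ->
  measurable_fun setT (log_ratio f g).
Proof.
move=> mf f0 mg g0.
apply: (measurability _ (ErealGenOInfty.measurableE R)) => _ [_ [a ->] <-].
rewrite [X in measurable X](_ : _ =
  setT `&` [set x | (expR a * f x)%:E < (g x)%:E]); last first.
  by rewrite preimage_itvoy; congr (_ `&` _); apply/seteqP; split => x /=;
    rewrite lte_log_ratio.
apply: measurable_lte => //; apply/measurable_EFinP => //.
exact: measurable_funM.
Qed.

Section no_alarm.
Context d d' (Omega : measurableType d) (E : measurableType d').
Context (R : realType).
Variables (X : nat -> {mfun Omega >-> E}) (f g : nat -> E -> R) (A : R).
Hypothesis mlr : forall n, (1 <= n)%N ->
  measurable_fun setT (log_ratio (f n) (g n)).

(** The event {tau > m}, see [no_alarmP]. *)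
Definition no_alarm (m : nat) : set Omega :=
  [set w | forall n, (1 <= n <= m)%N -> cusum X f g n w <= A%:E].

Lemma no_alarmS m n : (m <= n)%N -> no_alarm n `<=` no_alarm m.
Proof.
move=> mn w wn k /andP[k1 km]; apply: wn; rewrite k1; exact: leq_trans mn.
Qed.

Lemma no_alarm0 : no_alarm 0 = setT.
Proof. by apply/seteqP; split => // w _ [|n]. Qed.

Lemma no_alarmP m w : no_alarm m w <-> m.+1%:R%:E <= cusum_time X f g A w.
Proof.
split.
  move=> wm; apply: le_ereal_inf_tmp => _ [n [n1 An] <-].
  rewrite lee_fin ler_nat ltnNge; apply/negP => nm.
  by move: An; apply/negP; rewrite -leNgt; apply: wm; rewrite n1.
move=> mt n /andP[n1 nm]; rewrite leNgt; apply/negP => An.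
have : cusum_time X f g A w <= n%:R%:E by apply: ereal_inf_lbound; exists n.
by move=> /(le_trans mt); rewrite lee_fin ler_nat ltnNge nm.
Qed.

Lemma cusum_gt n k w : (1 <= k <= n)%N ->
  A%:E < \sum_(k <= i < n.+1) log_ratio (f i) (g i) (X i w) ->
  A%:E < cusum X f g n w.
Proof.
move=> /andP[k1 kn] /lt_le_trans; apply; rewrite /cusum.
have kin : k \in index_iota 1 n.+1 by rewrite mem_index_iota k1 ltnS.
by apply: (le_bigmax_seq _ k) kin _.
Qed.

Lemma past_cusum n nu : (n < nu)%N ->
  measurable_fun [set: pastType X nu]
    (cusum X f g n : pastType X nu -> \bar R).
Proof.
move=> nnu; apply: emeasurable_big => [u v mu mv|k].
  exact: measurable_maxe.
rewrite mem_index_iota => /andP[k1 _].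
apply: emeasurable_big => [u v mu mv|i]; first exact: emeasurable_funD.
rewrite mem_index_iota => /andP[ki iN].
have i1 : (1 <= i)%N := leq_trans k1 ki.
apply: (measurableT_comp (mlr i1)); apply: measurable_past_X.
by rewrite i1 (leq_trans _ nnu).
Qed.

Lemma past_no_alarm m nu : (m < nu)%N -> past X nu (no_alarm m).
Proof.
move=> mnu.
have -> : no_alarm m = \bigcap_(n in [set n | (1 <= n <= m)%N])
    [set w | cusum X f g n w <= A%:E].
  by apply/seteqP; split => w wm n; exact: wm.
rewrite -[past _ _]/(@measurable _ (pastType X nu)).
apply: bigcap_measurableType => n /= /andP[_ nm].
rewrite -[X in measurable X]setTI.
apply: emeasurable_fun_infty_c => //.
exact: past_cusum (leq_ltn_trans nm mnu).
Qed.

Lemma measurable_no_alarm m : measurable (no_alarm m).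
Proof. exact: (past_measurable (past_no_alarm (ltnSn m))). Qed.

(** The layer-cake formula E[tau] = sum of P(tau > m), before taking means. *)
Lemma cusum_time_series w :
  cusum_time X f g A w = \sum_(m <oo) (\1_(no_alarm m) w)%:E.
Proof.
have part n : \sum_(0 <= m < n) (\1_(no_alarm m) w : R)%:E <=
    cusum_time X f g A w.
  elim: n => [|n IH].
    rewrite big_geq//; apply: le_ereal_inf_tmp => _ [n [n1 An] <-].
    by rewrite lee_fin.
  have [wn|wn] := pselect (no_alarm n w).
    move: (wn) => /no_alarmP; apply: le_trans.
    rewrite (eq_big_nat _ _ (F2 := fun=> 1)); last first.
      move=> i /andP[_ iN]; rewrite indicE mem_set//.
      exact: (no_alarmS _ wn).
    by rewrite sumEFin big_const_nat iter_addr_0 subn0.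
  by rewrite big_nat_recr//= indicE memNset// adde0.
apply/eqP; rewrite eq_le; apply/andP; split; last first.
  apply: lime_le; first by apply: is_cvg_nneseries => n _ _; rewrite lee_fin.
  exact: nearW.
have [[m wm]|wA] := pselect (exists m, ~ no_alarm m w); last first.
  suff -> : \sum_(m <oo) (\1_(no_alarm m) w : R)%:E = +oo by rewrite leey.
  apply/eqyP => r r0.
  apply: le_trans (nneseries_lim_ge (Num.truncn r).+1 _); last first.
    by move=> n _ _; rewrite lee_fin.
  rewrite (eq_big_nat _ _ (F2 := fun=> 1)); last first.
    move=> i _; rewrite indicE mem_set//; apply: contrapT => iA.
    by apply: wA; exists i.
  rewrite sumEFin big_const_nat iter_addr_0 subn0 lee_fin.
  exact/ltW/truncnS_gt.
have wex : exists m, `[< ~ no_alarm m w >] by exists m; exact/asboolP.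
pose m0 := ex_minn wex.
have [m0w m0min] : ~ no_alarm m0 w /\ forall m, (m < m0)%N -> no_alarm m w.
  rewrite /m0; case: ex_minnP => k /asboolP kw kmin; split => // j jk.
  apply: contrapT => /asboolP /kmin; by rewrite leqNgt jk.
have m0lt : cusum_time X f g A w <= m0%:R%:E.
  have [n] : exists n, ~ ((1 <= n <= m0)%N -> cusum X f g n w <= A%:E).
    exact/existsNP.
  move=> /not_implyP[/andP[n1 nm] /negP]; rewrite -ltNge => An.
  apply: (@le_trans _ _ n%:R%:E); first by apply: ereal_inf_lbound; exists n.
  by rewrite lee_fin ler_nat.
apply: (le_trans m0lt).
apply: le_trans (nneseries_lim_ge m0 _); last first.
  by move=> n _ _; rewrite lee_fin.
rewrite (eq_big_nat _ _ (F2 := fun=> 1)); last first.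
  by move=> i /andP[_ im]; rewrite indicE mem_set//; exact: m0min.
by rewrite sumEFin big_const_nat iter_addr_0 subn0.
Qed.

Lemma measurable_cusum_time : measurable_fun setT (cusum_time X f g A).
Proof.
rewrite (_ : cusum_time X f g A =
  fun w => \sum_(m <oo) (\1_(no_alarm m) w : R)%:E); last first.
  by apply/funext => w; exact: cusum_time_series.
apply: ge0_emeasurable_sum.
  by move=> k w _ _; rewrite lee_fin.
move=> k _; apply/measurable_EFinP; apply: measurable_indic.
exact: measurable_no_alarm.
Qed.

End no_alarm.

(** * False alarms: the Shiryaev-Roberts statistic *)

(** Equality may fail only where f vanishes, which is why a likelihood ratio can
    have a mean smaller than 1. *)
Lemma expeR_log_ratio_mul_le d (E : measurableType d) (R : realType)
    (f g : E -> R) x : (0 <= f x)%R -> (0 <= g x)%R ->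
  expeR (log_ratio f g x) * (f x)%:E <= (g x)%:E.
Proof.
move=> f0 g0; rewrite /log_ratio lneK; last first.
  by rewrite in_itv/= leey andbT mule_ge0// ?inve_ge0 ?lee_fin.
have [->|fx0] := eqVneq (f x) 0%R; first by rewrite mule0 lee_fin.
by rewrite inver (negbTE fx0) -!EFinM -mulrA mulVf// mulr1.
Qed.

Lemma measurable_expeR (R : realType) : measurable_fun setT (@expeR R).
Proof.
apply: (measurability _ (ErealGenOInfty.measurableE R)) => _ [_ [a ->] <-].
rewrite preimage_itvoy setTI; have [a0|a0] := ltP a 0%R.
  rewrite (_ : [set _ | _] = setT); first exact: measurableT.
  apply/seteqP; split => // x _ /=.
  by rewrite (lt_le_trans _ (expeR_ge0 x))// lte_fin.
rewrite (_ : [set _ | _] = `]lne a%:E, +oo[%classic).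
  exact: emeasurable_itv.
have E : expeR (lne a%:E) = a%:E by rewrite lneK// in_itv/= leey lee_fin a0.
by rewrite -{1}E set_itvE; apply/seteqP; split => x /=; rewrite lte_expeR.
Qed.

Lemma integral_probability_indic d (T : measurableType d) (R : realType)
  (P : probability T R) (B : set T) : measurable B ->
  \int[P]_w (\1_B w)%:E = P B.
Proof. by move=> mB; rewrite integral_indic// setIT. Qed.

Section false_alarm.
Context d d' (Omega : measurableType d) (E : measurableType d').
Context (R : realType).
Variables (mu : {measure set E -> \bar R}) (X : nat -> {mfun Omega >-> E}).
Variables (f g : nat -> E -> R) (P : probability Omega R) (beta : R).
Hypothesis df : forall n, (1 <= n)%N -> is_density mu (f n).
Hypothesis dg : forall n, (1 <= n)%N -> is_density mu (g n).
Hypothesis PX : no_change_law P mu X f.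
Hypothesis beta0 : (0 < beta)%R.

Let lr n (x : E) : \bar R := expeR (log_ratio (f n) (g n) x).
Let N := no_alarm X f g (ln beta).

Let mlog n : (1 <= n)%N -> measurable_fun setT (log_ratio (f n) (g n)).
Proof.
move=> n1; have [mf f0 _] := df n1; have [mg g0 _] := dg n1.
exact: measurable_log_ratio.
Qed.

Let mlr n : (1 <= n)%N -> measurable_fun setT (lr n).
Proof.
by move=> n1; apply: measurableT_comp (mlog n1); exact: measurable_expeR.
Qed.

Fixpoint shiryaev_roberts (n : nat) (w : Omega) : \bar R :=
  if n is n'.+1 then (shiryaev_roberts n' w + 1) * lr n (X n w) else 0.

Let SR := shiryaev_roberts.

Lemma shiryaev_roberts_ge0 n w : 0 <= SR n w.
Proof.
elim: n => [|n IH] //=; apply: mule_ge0; last exact: expeR_ge0.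
exact: adde_ge0.
Qed.

Lemma past_shiryaev_roberts n :
  measurable_fun [set: pastType X n.+1] (SR n : pastType X n.+1 -> \bar R).
Proof.
suff H m : (n <= m)%N ->
    measurable_fun [set: pastType X m.+1] (SR n : pastType X m.+1 -> \bar R).
  exact: H.
elim: n m => [|n IH] m nm /=; first exact: measurable_cst.
apply: emeasurable_funM.
  by apply: emeasurable_funD => //; apply: IH; exact: ltnW.
by apply: (measurableT_comp (mlr _)) => //; apply: measurable_past_X.
Qed.

Lemma expeR_cusum_le n w : expeR (cusum X f g n w) <= SR n w.
Proof.
rewrite /cusum big_seq.
apply: (big_ind (fun y => expeR y <= SR n w)).
- exact: shiryaev_roberts_ge0.
- by move=> x y xn yn; rewrite /maxe; case: ifP.
move=> k; rewrite mem_index_iota => /andP[k1].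
elim: n => [|n IH]; first by rewrite ltnS leqn0 => /eqP k0; rewrite k0 in k1.
rewrite ltnS leq_eqVlt => /predU1P[->|kn].
  rewrite big_nat1 /= -[leLHS]mul1e; apply: lee_wpmul2r; first exact: expeR_ge0.
  by rewrite leeDr// shiryaev_roberts_ge0.
rewrite big_nat_recr/=; last exact: ltnW.
rewrite expeRD; apply: lee_wpmul2r; first exact: expeR_ge0.
by rewrite (le_trans (IH kn))// leeDl.
Qed.

Lemma integral_lr_le1 n : (1 <= n)%N -> \int[P]_w lr n (X n w) <= 1.
Proof.
move=> n1; have [mf f0 _] := df n1; have [mg g0 intg] := dg n1.
rewrite (ge0_integral_density (PX.2 n n1))//; last 2 first.
- exact: mlr.
- by move=> x; exact: expeR_ge0.
rewrite -intg; apply: ge0_le_integral => //.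
- by move=> x _; rewrite mule_ge0 ?expeR_ge0 ?lee_fin.
- by apply: emeasurable_funM; [exact: mlr|exact/measurable_EFinP].
- exact/measurable_EFinP.
- by move=> x _; exact: expeR_log_ratio_mul_le.
Qed.

Let mN m : measurable (N m).
Proof. exact: measurable_no_alarm. Qed.

Let mSR m : measurable_fun setT (SR m).
Proof.
apply: (past_measurable_fun (X := X) (nu := m.+1)).
exact: past_shiryaev_roberts.
Qed.

Let mSRN m k : measurable_fun setT (fun w => SR m w * (\1_(N k) w)%:E).
Proof.
by apply: emeasurable_funM => //; exact/measurable_EFinP/measurable_indic.
Qed.

Let SRN_ge0 m k w : 0 <= SR m w * (\1_(N k) w)%:E.
Proof. by rewrite mule_ge0 ?shiryaev_roberts_ge0 ?lee_fin. Qed.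

(** Supermartingale property, restricted to the event of no alarm so far, which
    belongs to the past of the next observation. *)
Lemma shiryaev_roberts_step m :
  \int[P]_w (SR m.+1 w * (\1_(N m) w)%:E) <=
  \int[P]_w (SR m w * (\1_(N m) w)%:E) + P (N m).
Proof.
have -> : \int[P]_w (SR m w * (\1_(N m) w)%:E) + P (N m) =
    \int[P]_w ((SR m w + 1) * (\1_(N m) w)%:E).
  rewrite -(integral_probability_indic P (mN m)) -ge0_integralD//; last first.
    exact/measurable_EFinP/measurable_indic.
  apply: eq_integral => w _.
  by rewrite ge0_muleDl ?mul1e// shiryaev_roberts_ge0.
have Z0 w : 0 <= (SR m w + 1) * (\1_(N m) w)%:E.
  by rewrite mule_ge0 ?lee_fin// adde_ge0 ?shiryaev_roberts_ge0.
rewrite (eq_integral (fun w => ((SR m w + 1) * (\1_(N m) w)%:E) *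
    lr m.+1 (X m.+1 w))); last by move=> w _; rewrite /= muleAC.
rewrite (ge0_integral_past_prod PX.1)//; last 4 first.
- apply: emeasurable_funM.
    by apply: emeasurable_funD => //; exact: past_shiryaev_roberts.
  apply/measurable_EFinP; apply: measurable_indic.
  exact: past_no_alarm.
- exact: mlr.
- by move=> x; exact: expeR_ge0.
- by rewrite (le_lt_trans (integral_lr_le1 _))// ltry.
rewrite -[leRHS]mule1; apply: lee_wpmul2l; first exact: integral_ge0.
exact: integral_lr_le1.
Qed.

(** On the event that the first alarm is raised at m + 1, the statistic is at
    least exp W_(m+1) > beta. *)
Lemma alarm_shiryaev_roberts m :
  \int[P]_w (SR m.+1 w * (\1_(N m.+1) w)%:E) + beta%:E * P (N m `\` N m.+1) <=
  \int[P]_w (SR m.+1 w * (\1_(N m) w)%:E).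
Proof.
have mD : measurable (N m `\` N m.+1) by exact: measurableD.
rewrite -(integral_probability_indic P mD) -ge0_integralZl//; last 2 first.
- exact/measurable_EFinP/measurable_indic.
- by rewrite lee_fin ltW.
rewrite -ge0_integralD//; last 2 first.
- by move=> w _; rewrite mule_ge0 ?lee_fin// ltW.
- by apply: measurable_funeM; exact/measurable_EFinP/measurable_indic.
apply: ge0_le_integral => //.
- by move=> w _; rewrite adde_ge0// mule_ge0 ?lee_fin// ltW.
- apply: emeasurable_funD => //.
  by apply: measurable_funeM; exact/measurable_EFinP/measurable_indic.
move=> w _; rewrite !indicE.
have [wm|wm] := pselect (N m w); last first.
  have wm1 : ~ N m.+1 w by move/(no_alarmS (leqnSn m)).
  have wD : ~ (N m `\` N m.+1) w by case.
  by rewrite (memNset wm) (memNset wm1) (memNset wD) !mule0 adde0.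
rewrite (mem_set wm) mule1.
have [wm1|wm1] := pselect (N m.+1 w).
  have wD : ~ (N m `\` N m.+1) w by case.
  by rewrite (mem_set wm1) (memNset wD) mule1 mule0 adde0.
have wD : (N m `\` N m.+1) w by split.
rewrite (memNset wm1) (mem_set wD) mule0 add0e mule1.
have : ~ (forall n, (1 <= n <= m.+1)%N -> cusum X f g n w <= (ln beta)%:E).
  exact: wm1.
move=> /existsNP[n /not_implyP[/andP[n1]]].
rewrite leq_eqVlt => /predU1P[->|nm]; last first.
  by case; apply: wm; rewrite n1.
move=> /negP; rewrite -ltNge => /ltW bW.
apply: le_trans (expeR_cusum_le m.+1 w).
by rewrite -[leLHS](_ : expeR (ln beta)%:E = _) ?lee_expeR//= lnK.
Qed.

(** The statistic still running plus what has been collected at alarms is paid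
    for by one unit of mean per step without alarm. *)
Lemma shiryaev_roberts_telescope m :
  \int[P]_w (SR m w * (\1_(N m) w)%:E) + beta%:E * P (~` N m) <=
  \sum_(0 <= i < m) P (N i).
Proof.
elim: m => [|m IH].
  rewrite big_geq// /N no_alarm0 setCT measure0 mule0 adde0.
  by under eq_integral do rewrite /= mul0e; rewrite integral0.
rewrite big_nat_recr//=.
have -> : P (~` N m.+1) = P (N m `\` N m.+1) + P (~` N m).
  rewrite -measureU//.
  - congr (P _); apply/seteqP; split => w /= wm.
      have [wm'|wm'] := pselect (N m w); first by left.
      by right.
    case: wm => [[_]//|wm] wm1; apply: wm.
    exact: (no_alarmS (leqnSn m) wm1).
  - exact: measurableD.
  - exact: measurableC.
  - by apply/seteqP; split => w //= [[]].
rewrite ge0_muleDr// addeA.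
apply: (@le_trans _ _ (\int[P]_w (SR m w * (\1_(N m) w)%:E) + P (N m) +
    beta%:E * P (~` N m))).
  apply: leeD2r.
  exact: le_trans (alarm_shiryaev_roberts m) (shiryaev_roberts_step m).
by rewrite addeAC; exact: leeD2r.
Qed.

Lemma integral_cusum_timeE :
  \int[P]_w cusum_time X f g (ln beta) w = \sum_(i <oo) P (N i).
Proof.
under eq_integral do rewrite cusum_time_series.
rewrite integral_nneseries//; last first.
  by move=> n; exact/measurable_EFinP/measurable_indic.
by apply: eq_eseriesr => i _; exact: integral_probability_indic.
Qed.

Lemma expected_cusum_time_ge :
  beta%:E <= \int[P]_w cusum_time X f g (ln beta) w.
Proof.
rewrite integral_cusum_timeE leNgt; apply/negP => ltb.
set e := \sum_(i <oo) P (N i) in ltb.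
have e0 : 0 <= e by apply: nneseries_ge0 => n _ _.
have efin : e \is a fin_num by rewrite ge0_fin_numE// (lt_trans ltb)// ltry.
have part m : \sum_(0 <= i < m) P (N i) <= e.
  by apply: nneseries_lim_ge => n _ _.
(* If the mean e were below beta, the bound beta * P(tau <= m) <= e would keep
   P(tau > m) above c > 0 for all m, and their sum could not be e. *)
pose c := (1 - fine e / beta)%R.
have c0 : (0 < c)%R.
  by rewrite subr_gt0 ltr_pdivrMr// mul1r -lte_fin fineK.
have qc m : c%:E <= P (N m).
  have := le_trans (shiryaev_roberts_telescope m) (part m).
  move=> /(le_trans (leeDr _ (integral_ge0 _ (fun w _ => SRN_ge0 m m w)))).
  rewrite probability_setC//.
  rewrite -(fineK (fin_num_measure P _ (mN m))) -(fineK efin).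
  rewrite -EFinB -EFinM !lee_fin /c => H.
  rewrite lerBlDr -lerBlDl ler_pdivlMr// mulrC.
  exact: H.
have := part (Num.truncn (fine e / c)).+1; rewrite leNgt => /negP; apply.
apply: (@lt_le_trans _ _ (\sum_(0 <= i < (Num.truncn (fine e / c)).+1) c%:E)).
  rewrite sumEFin big_const_nat iter_addr_0 subn0.
  rewrite -[ltLHS]fineK// lte_fin -mulr_natl -ltr_pdivrMr//.
  exact: truncnS_gt.
by apply: lee_sum => i _.
Qed.

End false_alarm.

(** * Crossing times of a truncated random walk *)

(** A random walk started just after time nu, with steps zp - zn given by their
    parts zp (bounded by M) and zn (possibly infinite).  Keeping the two parts
    apart avoids all subtractions of infinite values. *)
Section delay.
Context d d' (Omega : measurableType d) (E : measurableType d').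
Context (R : realType).
Variables (X : nat -> {mfun Omega >-> E}) (P : probability Omega R).
Hypothesis Xind : mutually_independent P X.
Variables (nu : nat) (zp zn : nat -> E -> \bar R) (A M : R) (a b : nat -> R).
Hypothesis A0 : (0 <= A)%R.
Hypothesis M0 : (0 <= M)%R.
Hypothesis mzp : forall n, (1 <= n)%N -> measurable_fun setT (zp n).
Hypothesis mzn : forall n, (1 <= n)%N -> measurable_fun setT (zn n).
Hypothesis zp0 : forall n x, 0 <= zp n x.
Hypothesis zn0 : forall n x, 0 <= zn n x.
Hypothesis zpM : forall n x, zp n x <= M%:E.
Hypothesis azp : forall i,
  \int[P]_w zp (nu + i).+1 (X (nu + i).+1 w) = (a i)%:E.
Hypothesis bzn : forall i,
  \int[P]_w zn (nu + i).+1 (X (nu + i).+1 w) = (b i)%:E.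

Let up i w : \bar R := zp (nu + i).+1 (X (nu + i).+1 w).
Let dn i w : \bar R := zn (nu + i).+1 (X (nu + i).+1 w).

(** Survival of the walk below A for j steps, with the downward parts moved to
    the right-hand side because they may be infinite. *)
Definition below (j : nat) : set Omega :=
  [set w | forall l, (l <= j)%N ->
    \sum_(0 <= i < l) up i w <= A%:E + \sum_(0 <= i < l) dn i w].

Lemma belowS i j : (i <= j)%N -> below j `<=` below i.
Proof. by move=> ij w wj l li; apply: wj; exact: leq_trans ij. Qed.

Lemma below0 : below 0 = setT.
Proof.
apply/seteqP; split => // w _ l; rewrite leqn0 => /eqP ->.
by rewrite !big_geq// adde0 lee_fin.
Qed.

Lemma past_below j : past X (nu + j).+1 (below j).
Proof.
have -> : below j = \bigcap_(l in [set l | (l <= j)%N])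
    [set w | \sum_(0 <= i < l) up i w <= A%:E + \sum_(0 <= i < l) dn i w].
  by apply/seteqP; split => w wl l; exact: wl.
rewrite -[past _ _]/(@measurable _ (pastType X (nu + j).+1)).
apply: bigcap_measurableType => l /= lj.
have H (z : nat -> E -> \bar R) : (forall n, (1 <= n)%N ->
    measurable_fun setT (z n)) ->
    measurable_fun [set: pastType X (nu + j).+1]
      (fun w => \sum_(0 <= i < l) z (nu + i).+1 (X (nu + i).+1 w)).
  move=> mz; apply: emeasurable_big => [u v mu mv|i].
    exact: emeasurable_funD.
  rewrite mem_index_iota => /andP[_ il].
  apply: (measurableT_comp (mz _ _)) => //; apply: measurable_past_X.
  by rewrite /= ltnS ltn_add2l (leq_trans il).
rewrite -[X in measurable X]setTI.
apply: measurable_lee => //; first exact: H.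
by apply: emeasurable_funD => //; exact: H.
Qed.

Lemma measurable_below j : measurable (below j).
Proof. exact: (past_measurable (@past_below j)). Qed.

(** The stopped walk exceeds A by at most its last step. *)
Lemma overshoot_le n w :
  \sum_(0 <= i < n) (up i w * (\1_(below i) w)%:E) <=
  (A + M)%:E + \sum_(0 <= i < n) (dn i w * (\1_(below i) w)%:E).
Proof.
elim: n => [|n IH].
  by rewrite !big_geq// adde0 lee_fin addr_ge0.
rewrite !big_nat_recr//=.
have [wn|wn] := pselect (below n w); last first.
  by rewrite indicE (memNset wn) !mule0 !adde0.
have one (z : nat -> Omega -> \bar R) :
    \sum_(0 <= i < n) (z i w * (\1_(below i) w)%:E) =
    \sum_(0 <= i < n) z i w.
  apply: eq_big_nat => i /andP[_ iN].
  by rewrite indicE mem_set ?mule1//; exact: (belowS (ltnW iN)).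
rewrite !one indicE (mem_set wn) !mule1 EFinD.
apply: (@le_trans _ _ (A%:E + \sum_(0 <= i < n) dn i w + M%:E)).
  by apply: leeD; [exact: wn|exact: zpM].
rewrite -!addeA leeD2lE// addeC; apply: leeD => //.
by rewrite leeDl// zn0.
Qed.

Let muX i (z : nat -> E -> \bar R) :
  (forall n, (1 <= n)%N -> measurable_fun setT (z n)) ->
  measurable_fun setT (fun w => z (nu + i).+1 (X (nu + i).+1 w)).
Proof. by move=> mz; apply: measurableT_comp => //; exact: mz. Qed.

(** Wald's argument on B: step i is independent of the event of the past that
    it is taken, so its mean over that event is its drift times the
    probability of the event. *)
Lemma stopped_drift_le B n : past X nu.+1 B ->
  (\sum_(0 <= i < n) (a i - b i) * fine (P (B `&` below i)) <=
   (A + M) * fine (P B))%R.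
Proof.
move=> pB; have mB := past_measurable pB.
have pBU i : past X (nu + i).+1 (B `&` below i).
  rewrite -[past _ _]/(@measurable _ (pastType X (nu + i).+1)).
  apply: measurableI; last exact: past_below.
  by apply: (pastS _ pB); rewrite ltnS leq_addr.
have mBU i : measurable (B `&` below i) by exact: (past_measurable (pBU i)).
have fBU i : P (B `&` below i) \is a fin_num by exact: fin_num_measure.
have H : \sum_(0 <= i < n) ((a i)%:E * P (B `&` below i)) <=
    (A + M)%:E * P B + \sum_(0 <= i < n) ((b i)%:E * P (B `&` below i)).
  have E1 (z : nat -> E -> \bar R) (c : nat -> R) :
      (forall n, (1 <= n)%N -> measurable_fun setT (z n)) ->
      (forall n x, 0 <= z n x) ->
      (forall i, \int[P]_w z (nu + i).+1 (X (nu + i).+1 w) = (c i)%:E) ->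
      \sum_(0 <= i < n) ((c i)%:E * P (B `&` below i)) =
      \int[P]_w (\sum_(0 <= i < n)
        (z (nu + i).+1 (X (nu + i).+1 w) * (\1_(B `&` below i) w)%:E)).
    move=> mz z0 zc; rewrite ge0_integral_sum//.
    - apply: eq_big_nat => i _.
      rewrite (ge0_integral_past_indic Xind) ?zc//; exact: mz.
    - move=> i; apply: emeasurable_funM; first exact: muX.
      exact/measurable_EFinP/measurable_indic.
    - by move=> i w _; rewrite mule_ge0// lee_fin.
  rewrite (E1 zp)// (E1 zn)//.
  rewrite -(integral_probability_indic P mB) -ge0_integralZl//; last 2 first.
  - exact/measurable_EFinP/measurable_indic.
  - by rewrite lee_fin addr_ge0.
  have mind (z : nat -> E -> \bar R) :
      (forall n, (1 <= n)%N -> measurable_fun setT (z n)) ->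
      measurable_fun setT (fun w => \sum_(0 <= i < n)
        (z (nu + i).+1 (X (nu + i).+1 w) * (\1_(B `&` below i) w)%:E)).
    move=> mz; apply: emeasurable_sum => i.
    apply: emeasurable_funM; first exact: muX.
    exact/measurable_EFinP/measurable_indic.
  have sum0 (z : nat -> E -> \bar R) w : (forall n x, 0 <= z n x) ->
      0 <= \sum_(0 <= i < n)
        (z (nu + i).+1 (X (nu + i).+1 w) * (\1_(B `&` below i) w)%:E).
    by move=> z0; apply: sume_ge0 => i _; rewrite mule_ge0// lee_fin.
  have m1 : measurable_fun setT (fun w => (A + M)%:E * (\1_B w)%:E : \bar R).
    by apply: measurable_funeM; exact/measurable_EFinP/measurable_indic.
  have AM1 w : 0 <= (A + M)%:E * (\1_B w)%:E.
    by rewrite mule_ge0// lee_fin ?addr_ge0.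
  rewrite -ge0_integralD//; last 2 first.
  - by move=> w _; exact: sum0.
  - exact: mind.
  apply: ge0_le_integral => //.
  - by move=> w _; exact: sum0.
  - exact: mind.
  - by apply: emeasurable_funD => //; exact: mind.
  move=> w _; have [wB|wB] := pselect (B w).
    rewrite [\1_B w]indicE (mem_set wB) mule1.
    have BU i : \1_(B `&` below i) w = \1_(below i) w :> R.
      rewrite !indicE; congr (_ %:R); congr nat_of_bool.
      by rewrite in_setI (mem_set wB).
    under eq_bigr do rewrite BU; under [X in _ + X]eq_bigr do rewrite BU.
    exact: overshoot_le.
  have BU i : \1_(B `&` below i) w = 0%R :> R.
    by rewrite indicE memNset// => -[].
  rewrite big1; last by move=> i _; rewrite BU mule0.
  by rewrite adde_ge0// sum0.
under eq_bigr do rewrite mulrBl.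
rewrite sumrB lerBlDr -lee_fin EFinD EFinM -!sumEFin fineK ?fin_num_measure//.
under eq_bigr do rewrite EFinM fineK//.
by under [X in _ + X]eq_bigr do rewrite EFinM fineK//.
Qed.

Lemma sum_below_le B C J n : past X nu.+1 B -> (0 < J)%R ->
  (forall m, - C <= \sum_(0 <= i < m) (a i - b i - J))%R ->
  (\sum_(0 <= i < n) fine (P (B `&` below i)) <=
   (A + M + C) / J * fine (P B))%R.
Proof.
move=> pB J0 DC; have mB := past_measurable pB.
have q0 i : (0 <= fine (P (B `&` below i)))%R by exact: fine_ge0.
have qS i : (fine (P (B `&` below i.+1)) <= fine (P (B `&` below i)))%R.
  have mBU k : measurable (B `&` below k).
    by apply: measurableI => //; exact: measurable_below.
  apply: fine_le; [exact: fin_num_measure..|].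
  by apply: le_measure; rewrite ?inE//; apply: setIS; exact: belowS.
have := abel_sum_ge DC q0 qS n.
rewrite below0 setIT => H.
have H' := stopped_drift_le n pB.
pose q i := fine (P (B `&` below i)).
have qE : (\sum_(0 <= i < n) (a i - b i - J) * q i =
    \sum_(0 <= i < n) (a i - b i) * q i - J * \sum_(0 <= i < n) q i)%R.
  by rewrite mulr_sumr -sumrB; apply: eq_bigr => i _; rewrite mulrBl.
rewrite qE in H; move: H H'; rewrite -/q.
set S := (\sum_(_ <= _ < _) _)%R; set Q := (\sum_(_ <= _ < _) _)%R => H1 H2.
rewrite mulrAC ler_pdivlMr// mulrC !mulrDl; rewrite !mulrDl in H2; lra.
Qed.

End delay.

(** * Truncated drifts and the Kullback-Leibler divergence *)

Section divergence.
Context d (E : measurableType d) (R : realType).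
Variables (mu : {measure set E -> \bar R}) (f g : E -> R).
Hypothesis df : is_density mu f.
Hypothesis dg : is_density mu g.

Let l := log_ratio f g.

(** The positive part of the log-likelihood ratio, cut at M.  The cut bounds the
    overshoot of the walk, so that only first moments enter the argument. *)
Definition up_step (M : R) (x : E) : \bar R := mine (l^\+ x) M%:E.
Definition down_step (x : E) : \bar R := l^\- x.

Let f0 x : (0 <= f x)%R. Proof. by have [] := df. Qed.
Let g0 x : (0 <= g x)%R. Proof. by have [] := dg. Qed.

Let mf : measurable_fun setT f. Proof. by have [] := df. Qed.
Let mg : measurable_fun setT g. Proof. by have [] := dg. Qed.
Let mgE : measurable_fun setT (EFin \o g). Proof. exact/measurable_EFinP. Qed.

Let ml : measurable_fun setT l.
Proof. exact: measurable_log_ratio. Qed.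

Lemma up_step_ge0 M x : (0 <= M)%R -> 0 <= up_step M x.
Proof. by move=> M0; rewrite le_min funepos_ge0 lee_fin. Qed.

Lemma up_step_le M x : up_step M x <= M%:E.
Proof. by rewrite ge_min lexx orbT. Qed.

Lemma down_step_ge0 x : 0 <= down_step x.
Proof. exact: funeneg_ge0. Qed.

Lemma measurable_up_step M : measurable_fun setT (up_step M).
Proof.
by apply: measurable_mine => //; exact: measurable_funepos.
Qed.

Lemma measurable_down_step : measurable_fun setT down_step.
Proof. exact: measurable_funeneg. Qed.

Lemma steps_le_log_ratio M x : down_step x < +oo ->
  up_step M x - down_step x <= l x.
Proof.
rewrite /up_step /down_step funeposE funenegE; case: (l x) => [r _| _|//].
- apply: (@le_trans _ _ (maxe r%:E 0 - maxe (- r%:E) 0)).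
    by apply: leeB => //; rewrite ge_min lexx.
  rewrite -EFinN; have [r0|/ltW r0] := leP 0%R r.
    have -> : maxe r%:E 0 = r%:E by apply: max_l; rewrite lee_fin.
    have -> : maxe (- r)%:E 0 = 0 by apply: max_r; rewrite lee_fin oppr_le0.
    by rewrite oppe0 adde0.
  have -> : maxe r%:E 0 = 0 by apply: max_r; rewrite lee_fin.
  have -> : maxe (- r)%:E 0 = (- r)%:E.
    by apply: max_l; rewrite lee_fin oppr_ge0.
  by rewrite add0e EFinN oppeK.
- by rewrite leey.
Qed.

(** A step goes down only where g < f, and there g * log (f / g) <= f. *)
Lemma integral_down_step_le1 : \int[mu]_x (down_step x * (g x)%:E) <= 1.
Proof.
have [_ _ <-] := df; apply: ge0_le_integral => //.
- by move=> x _; rewrite mule_ge0 ?lee_fin// down_step_ge0.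
- by apply: emeasurable_funM => //; exact: measurable_down_step.
- exact/measurable_EFinP.
move=> x _; rewrite /down_step funenegE /l /log_ratio.
have [->|gx0] := eqVneq (g x) 0%R; first by rewrite mule0 lee_fin.
have gx : (0 < g x)%R by rewrite lt_def gx0 g0.
have [->|fx0] := eqVneq (f x) 0%R.
  by rewrite inve0 gt0_muley ?lte_fin//= max_r ?mul0e// leNye.
have fx : (0 < f x)%R by rewrite lt_def fx0 f0.
rewrite inver (negbTE fx0) -EFinM lne_EFin ?divr_gt0//.
rewrite -EFinN -lnV ?posrE ?divr_gt0// invf_div.
have h : (ln (f x / g x) <= f x / g x)%R.
  by apply/ltW/ln_sublinear; rewrite divr_gt0.
apply: (@le_trans _ _ ((f x / g x)%:E * (g x)%:E)).
  apply: lee_wpmul2r; first by rewrite lee_fin.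
  by rewrite ge_max !lee_fin h divr_ge0.
by rewrite -EFinM divfK.
Qed.

Lemma kl_divergenceE : kl_divergence mu g f =
  \int[mu]_x (l^\+ x * (g x)%:E) - \int[mu]_x (down_step x * (g x)%:E).
Proof.
rewrite /kl_divergence integralE; congr (_ - _); apply: eq_integral => x _.
  by rewrite !funeposE maxe_pMl ?lee_fin// mul0e muleC.
by rewrite /down_step !funenegE maxe_pMl ?lee_fin// mul0e -muleN muleC.
Qed.

Lemma kl_divergence_gtNy : -oo < kl_divergence mu g f.
Proof.
rewrite kl_divergenceE; apply: (@lt_le_trans _ _ (-1)); first exact: ltNyr.
rewrite -[leLHS]add0e; apply: leeD.
  by apply: integral_ge0 => x _; rewrite mule_ge0 ?lee_fin.
by rewrite leeN2 integral_down_step_le1.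
Qed.

Hypothesis klfin : kl_divergence mu g f < +oo.

Lemma integral_up_lty : \int[mu]_x (l^\+ x * (g x)%:E) < +oo.
Proof.
move: klfin; rewrite kl_divergenceE.
have d0 : 0 <= \int[mu]_x (down_step x * (g x)%:E).
  by apply: integral_ge0 => x _; rewrite mule_ge0 ?lee_fin// down_step_ge0.
have dfin : \int[mu]_x (down_step x * (g x)%:E) \is a fin_num.
  by rewrite ge0_fin_numE// (le_lt_trans integral_down_step_le1)// ltry.
by rewrite lteBlDr// => /lt_le_trans; apply; exact: leey.
Qed.

(** The mean under g of a log-likelihood ratio cut at M. *)
Definition drift (M : R) : R :=
  fine (\int[mu]_x (up_step M x * (g x)%:E)) -
  fine (\int[mu]_x (down_step x * (g x)%:E)).

Lemma integral_up_step_fin M : (0 <= M)%R ->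
  \int[mu]_x (up_step M x * (g x)%:E) \is a fin_num.
Proof.
move=> M0; rewrite ge0_fin_numE; last first.
  by apply: integral_ge0 => x _; rewrite mule_ge0 ?lee_fin// up_step_ge0.
apply: le_lt_trans integral_up_lty; apply: ge0_le_integral => //.
- by move=> x _; rewrite mule_ge0 ?lee_fin// up_step_ge0.
- by apply: emeasurable_funM => //; exact: measurable_up_step.
- by apply: emeasurable_funM => //; exact: measurable_funepos.
move=> x _; apply: lee_wpmul2r; first by rewrite lee_fin.
by rewrite ge_min lexx.
Qed.

Lemma integral_down_step_fin :
  \int[mu]_x (down_step x * (g x)%:E) \is a fin_num.
Proof.
rewrite ge0_fin_numE.
  by rewrite (le_lt_trans integral_down_step_le1)// ltry.
by apply: integral_ge0 => x _; rewrite mule_ge0 ?lee_fin// down_step_ge0.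
Qed.

Lemma drift_geN1 M : (0 <= M)%R -> (-1 <= drift M)%R.
Proof.
move=> M0; rewrite /drift.
have a0 : (0 <= fine (\int[mu]_x (up_step M x * (g x)%:E)))%R.
  apply: fine_ge0; apply: integral_ge0 => x _.
  by rewrite mule_ge0 ?lee_fin// up_step_ge0.
have b1 : (fine (\int[mu]_x (down_step x * (g x)%:E)) <= 1)%R.
  by rewrite -lee_fin fineK ?integral_down_step_fin// integral_down_step_le1.
by lra.
Qed.

Lemma kl_divergence_fin : kl_divergence mu g f \is a fin_num.
Proof.
rewrite kl_divergenceE fin_numB integral_down_step_fin andbT.
rewrite ge0_fin_numE ?integral_up_lty//.
by apply: integral_ge0 => x _; rewrite mule_ge0 ?lee_fin.
Qed.

Lemma cvg_drift : drift n%:R @[n --> \oo] --> fine (kl_divergence mu g f).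
Proof.
have upfin : \int[mu]_x (l^\+ x * (g x)%:E) \is a fin_num.
  rewrite ge0_fin_numE ?integral_up_lty//.
  by apply: integral_ge0 => x _; rewrite mule_ge0 ?lee_fin.
rewrite kl_divergenceE fineB//; last exact: integral_down_step_fin.
apply: cvgB; last exact: cvg_cst.
apply: fine_cvg; rewrite fineK//.
have pw x : up_step n%:R x * (g x)%:E @[n --> \oo] --> l^\+ x * (g x)%:E.
  apply: cvgeZr => //; rewrite /up_step.
  have := funepos_ge0 l x; case: (l^\+ x) => [r r0|_|//].
    apply: cvg_near_cst; near=> n; apply: min_l; rewrite lee_fin.
    by near: n; exact: nbhs_infty_ger.
  under eq_fun do rewrite minye.
  apply/cvgeyPge => r; near=> n; rewrite lee_fin.
  by near: n; exact: nbhs_infty_ger.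
under [X in _ --> X]eq_integral => x _ do rewrite -(cvg_lim _ (pw x))//.
apply: cvg_monotone_convergence => //.
- move=> n; apply: emeasurable_funM => //; exact: measurable_up_step.
- by move=> n x _; rewrite mule_ge0 ?lee_fin// up_step_ge0.
- move=> x _ m n mn; apply: lee_wpmul2r; first by rewrite lee_fin.
  by rewrite le_min ge_min lexx/= ge_min lee_fin ler_nat mn orbT.
Unshelve. all: by end_near. Qed.

End divergence.

Section mean_drift.
Context d (E : measurableType d) (R : realType).
Variables (mu : {measure set E -> \bar R}) (T : nat) (f g : nat -> E -> R).
Hypothesis T0 : (0 < T)%N.
Hypothesis df : forall n, (1 <= n)%N -> is_density mu (f n).
Hypothesis dg : forall n, (1 <= n)%N -> is_density mu (g n).
Hypothesis Ifin : mean_divergence mu T f g < +oo.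

Lemma kl_divergence_lty i : (1 <= i < T.+1)%N ->
  kl_divergence mu (g i) (f i) < +oo.
Proof.
move=> /andP[i1 iT]; rewrite ltey; apply/eqP => kloo.
suff sumoo : \sum_(1 <= i < T.+1) kl_divergence mu (g i) (f i) = +oo.
  move: Ifin; rewrite /mean_divergence sumoo gt0_muley ?ltxx//.
  by rewrite lte_fin invr_gt0 ltr0n.
rewrite big_seq; apply/esum_eqyP => [j|].
  rewrite mem_index_iota => /andP[j1 _].
  by rewrite gt_eqF//; apply: kl_divergence_gtNy; [exact: df|exact: dg].
by exists i; rewrite mem_index_iota i1 iT.
Qed.

Definition mean_drift (M : R) : R :=
  T%:R^-1 * \sum_(1 <= i < T.+1) drift mu (f i) (g i) M.

Lemma cvg_mean_drift :
  mean_drift n%:R @[n --> \oo] --> fine (mean_divergence mu T f g).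
Proof.
have klE i : (1 <= i < T.+1)%N -> kl_divergence mu (g i) (f i) =
    (fine (kl_divergence mu (g i) (f i)))%:E.
  move=> iT; have /andP[i1 _] := iT; rewrite fineK//.
  by apply: kl_divergence_fin; [exact: df|exact: dg|exact: kl_divergence_lty].
rewrite /mean_drift /mean_divergence (eq_big_nat _ _ klE) sumEFin -EFinM /=.
apply: cvgM; first exact: cvg_cst.
rewrite [in X in _ --> X]big_seq.
under eq_fun do rewrite big_seq.
apply: cvg_big => [|i]; first exact: add_continuous.
rewrite mem_index_iota => iT; have /andP[i1 _] := iT.
by apply: cvg_drift; [exact: df|exact: dg|exact: kl_divergence_lty].
Qed.

End mean_drift.

(** * Detection delay of the CUSUM time *)

Section detection_delay.
Context d d' (Omega : measurableType d) (E : measurableType d').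
Context (R : realType).
Variables (mu : {measure set E -> \bar R}) (T : nat) (f g : nat -> E -> R).
Variables (X : nat -> {mfun Omega >-> E}) (P : probability Omega R).
Variables (nu : nat) (thr M : R).
Hypothesis T0 : (0 < T)%N.
Hypothesis df : forall n, (1 <= n)%N -> is_density mu (f n).
Hypothesis dg : forall n, (1 <= n)%N -> is_density mu (g n).
Hypothesis fT : forall n, (1 <= n)%N -> f (n + T)%N = f n.
Hypothesis gT : forall n, (1 <= n)%N -> g (n + T)%N = g n.
Hypothesis PX : change_law P mu X f g nu.+1.
Hypothesis Ifin : mean_divergence mu T f g < +oo.
Hypothesis M0 : (0 <= M)%R.

Let J := mean_drift mu T f g M.
Hypothesis J0 : (0 < J)%R.

Let A := Num.max thr 0%R.
Let N := no_alarm X f g thr.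
Let tau := cusum_time X f g thr.
Let zp n := up_step (f n) (g n) M.
Let zn n := down_step (f n) (g n).

(** The overshoot costs M and the variation of the drift within a period costs
    T (1 + J), because every drift is at least -1. *)
Definition delay_bound : R := (A + M + T%:R * (1 + J)) / J.

Let A0 : (0 <= A)%R. Proof. by rewrite /A le_max lexx orbT. Qed.

Lemma delay_bound_ge0 : (0 <= delay_bound)%R.
Proof.
rewrite divr_ge0//; last exact: ltW.
by rewrite !addr_ge0// mulr_ge0// addr_ge0// ltW.
Qed.

Let dr i := drift mu (f i) (g i) M.

Lemma drift_period i : (1 <= i)%N -> dr (i + T) = dr i.
Proof. by move=> i1; rewrite /dr fT// gT. Qed.

Let klT i : (1 <= i)%N -> kl_divergence mu (g i) (f i) < +oo.
Proof.
move=> i1; rewrite -(prednK i1) (divn_eq i.-1 T).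
elim: (i.-1 %/ T)%N => [|k IH].
  rewrite mul0n add0n; apply: (kl_divergence_lty T0 df dg Ifin).
  by rewrite /= !ltnS ltn_mod.
have -> : (k.+1 * T + i.-1 %% T).+1 = ((k * T + i.-1 %% T).+1 + T)%N.
  by rewrite mulSn addSn [in RHS]addnC addnA.
by rewrite fT// gT.
Qed.

Lemma drift_sum_ge m :
  (- (T%:R * (1 + J)) <= \sum_(0 <= i < m) (dr (nu + i).+1 - J))%R.
Proof.
have Dper i : (dr (nu + (i + T)).+1 - J = dr (nu + i).+1 - J)%R.
  by rewrite addnA -addSn drift_period.
apply: sum_periodic_ge => //.
- by rewrite addr_ge0// ltW.
- rewrite sumrB sumr_const_nat subn0.
  have /= -> := sum_period_shift (D := fun i => dr i.+1) _ nu.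
    suff -> : (\sum_(0 <= i < T) dr i.+1 = T%:R * J)%R.
      by rewrite mulr_natl subrr.
    rewrite /J /mean_drift mulrA mulfV ?mul1r ?big_add1//.
    by rewrite pnatr_eq0 -lt0n.
  by move=> i; rewrite -addSn drift_period.
move=> i; have H : (-1 <= dr (nu + i).+1)%R.
  by apply: drift_geN1 => //; [exact: df|exact: dg].
lra.
Qed.

Let mlog n : (1 <= n)%N -> measurable_fun setT (log_ratio (f n) (g n)).
Proof.
move=> n1; have [mf f0 _] := df n1; have [mg g0 _] := dg n1.
exact: measurable_log_ratio.
Qed.

Let mN m : measurable (N m).
Proof. exact: measurable_no_alarm. Qed.

Let law i : has_density P mu (X (nu + i).+1) (g (nu + i).+1).
Proof.
have [_ /(_ (nu + i).+1 isT)] := PX.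
by rewrite ltnS ltnNge leq_addr.
Qed.

(** The CUSUM statistic dominates the walk restarted at the change, which in
    turn dominates the cut walk. *)
Lemma no_alarm_below j : N (nu + j) `<=` below X nu zp zn A j.
Proof.
move=> w wN l lj; rewrite leNgt; apply/negP => cross.
have dnoo i : (0 <= i < l)%N -> zn (nu + i).+1 (X (nu + i).+1 w) < +oo.
  move=> il; rewrite ltey; apply/eqP => oo; move: cross; apply/negP.
  rewrite -leNgt (_ : \sum_(0 <= i < l) zn _ _ = +oo) ?addey// ?leey//.
  rewrite big_seq; apply/esum_eqyP => [k _|].
    by rewrite gt_eqF// (lt_le_trans _ (down_step_ge0 _ _ _))// ltNy0.
  by exists i; rewrite mem_index_iota.
have l0 : (0 < l)%N.
  by case: l cross {lj dnoo} => // ; rewrite !big_geq// adde0 lte_fin ltNge A0.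
have : ~ (A%:E < \sum_(nu.+1 <= i < (nu + l).+1) log_ratio (f i) (g i) (X i w)).
  move=> HA.
  have H : thr%:E < \sum_(nu.+1 <= i < (nu + l).+1)
      log_ratio (f i) (g i) (X i w).
    by apply: le_lt_trans HA; rewrite lee_fin le_max lexx.
  have kn : (1 <= nu.+1 <= nu + l)%N by rewrite /= -{1}(addn0 nu) ltn_add2l.
  have := cusum_gt kn H; apply/negP; rewrite -leNgt; apply: wN.
  by rewrite leq_add2l lj andbT addn_gt0 l0 orbT.
apply; apply: (@lt_le_trans _ _ (\sum_(0 <= i < l)
  (zp (nu + i).+1 (X (nu + i).+1 w) - zn (nu + i).+1 (X (nu + i).+1 w)))).
  pose p i := fine (zp (nu + i).+1 (X (nu + i).+1 w)).
  pose m i := fine (zn (nu + i).+1 (X (nu + i).+1 w)).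
  have pE i : zp (nu + i).+1 (X (nu + i).+1 w) = (p i)%:E.
    rewrite fineK// ge0_fin_numE ?up_step_ge0//.
    by rewrite (le_lt_trans (up_step_le _ _ _ _))// ltry.
  have mE i : (0 <= i < l)%N -> zn (nu + i).+1 (X (nu + i).+1 w) = (m i)%:E.
    by move=> il; rewrite fineK// ge0_fin_numE ?down_step_ge0// dnoo.
  rewrite (eq_big_nat _ _ (F2 := fun i => (p i - m i)%:E)); last first.
    by move=> i il; rewrite mE// pE EFinB.
  move: cross; rewrite (eq_big_nat _ _ mE).
  under [X in _ < X -> _]eq_bigr do rewrite pE.
  by rewrite !sumEFin -EFinD !lte_fin sumrB ltrBrDr.
have -> : \sum_(nu.+1 <= i < (nu + l).+1) log_ratio (f i) (g i) (X i w) =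
    \sum_(0 <= i < l) log_ratio (f (nu + i).+1) (g (nu + i).+1)
                        (X (nu + i).+1 w).
  rewrite -[X in index_iota X _](add0n nu.+1) big_addn subSS addKn.
  by apply: eq_big_nat => i _; rewrite addnS addnC.
rewrite !big_seq; apply: lee_sum => i; rewrite mem_index_iota => il.
by apply: steps_le_log_ratio; exact: dnoo.
Qed.

Lemma survival_sum_le B n : past X nu.+1 B ->
  (\sum_(0 <= i < n) fine (P (B `&` N (nu + i))) <=
   delay_bound * fine (P B))%R.
Proof.
move=> pB; have mB := past_measurable pB.
have mz i : (1 <= i)%N -> measurable_fun setT (zp i).
  by move=> i1; apply: measurable_up_step; [exact: df|exact: dg].
have mz' i : (1 <= i)%N -> measurable_fun setT (zn i).
  by move=> i1; apply: measurable_down_step; [exact: df|exact: dg].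
have H := @sum_below_le _ _ Omega E R X P PX.1 nu zp zn A M
  (fun i => fine (\int[mu]_x (zp (nu + i).+1 x * (g (nu + i).+1 x)%:E)))
  (fun i => fine (\int[mu]_x (zn (nu + i).+1 x * (g (nu + i).+1 x)%:E)))
  A0 M0 mz mz' (fun n x => up_step_ge0 _ _ _ M0)
  (fun n x => down_step_ge0 _ _ _) (fun n x => up_step_le _ _ _ _).
apply: le_trans (H _ _ _ _ J n pB J0 drift_sum_ge).
- apply: ler_sum => i _; apply: fine_le.
  + by apply: fin_num_measure; exact: measurableI.
  + apply: fin_num_measure; apply: measurableI => //.
    exact: measurable_below.
  apply: le_measure; rewrite ?inE.
  + exact: measurableI.
  + by apply: measurableI => //; exact: measurable_below.
  + by apply: setIS; exact: no_alarm_below.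
- move=> i; have [mg g0 _] := dg (isT : (1 <= (nu + i).+1)%N).
  rewrite (ge0_integral_density (law i))//.
  + rewrite fineK//; by apply: integral_up_step_fin => //;
      do ?[exact: df|exact: dg|exact: klT].
  + exact: mz.
  + by move=> x; exact: up_step_ge0.
- move=> i; have [mg g0 _] := dg (isT : (1 <= (nu + i).+1)%N).
  rewrite (ge0_integral_density (law i))//.
  + rewrite fineK//; by apply: integral_down_step_fin => //;
      do ?[exact: df|exact: dg].
  + exact: mz'.
  + by move=> x; exact: down_step_ge0.
Qed.

(** The number of m >= nu + 1 with tau > m, that is, the positive part of the
    delay. *)
Let residual w : \bar R := \sum_(j <oo) (\1_(N (j + nu.+1)) w)%:E.

Let residual_ge0 w : 0 <= residual w.
Proof. by apply: nneseries_ge0 => n _ _; rewrite lee_fin. Qed.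

Let mind k : measurable_fun setT (fun w => (\1_(N k) w)%:E : \bar R).
Proof. exact/measurable_EFinP/measurable_indic. Qed.

Let mresidual : measurable_fun setT residual.
Proof.
by apply: ge0_emeasurable_sum => // k w _ _; rewrite lee_fin.
Qed.

Lemma integral_residual_le B : past X nu.+1 B ->
  \int[P]_(w in B) residual w <= delay_bound%:E * P B.
Proof.
move=> pB; have mB := past_measurable pB.
rewrite integral_nneseries//; last first.
  by move=> n; exact: measurable_funTS.
apply: lime_le.
  apply: is_cvg_nneseries => n _ _; apply: integral_ge0 => w _.
  by rewrite lee_fin.
apply: nearW => n.
rewrite -(fineK (fin_num_measure P _ mB)) -EFinM.
apply: le_trans (_ : (\sum_(0 <= i < n) fine (P (B `&` N (nu + i))))%:E <= _);
  last by rewrite lee_fin; exact: survival_sum_le.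
rewrite -sumEFin; apply: lee_sum => i _.
rewrite integral_indic// fineK; last first.
  by apply: fin_num_measure; exact: measurableI.
rewrite setIC; apply: le_measure; rewrite ?inE; [exact: measurableI..|].
by apply: setIS; apply: no_alarmS; rewrite addnS addnC leqW.
Qed.

Lemma cusum_time_residual w :
  exists2 r : R, (0 <= r <= nu.+1%:R)%R & tau w = r%:E + residual w.
Proof.
exists (\sum_(0 <= i < nu.+1) \1_(N i) w)%R.
  apply/andP; split; first by apply: sumr_ge0 => i _.
  apply: (@le_trans _ _ (\sum_(0 <= i < nu.+1) 1)%R).
    by apply: ler_sum => i _; rewrite indicE; case: (_ \in _).
  by rewrite sumr_const_nat subn0.
rewrite /tau cusum_time_series (nneseries_split 0 nu.+1); last first.
  by move=> k _; rewrite lee_fin.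
rewrite sumEFin add0n; congr (_ + _); apply/esym.
apply: (nneseries_addn (f := fun m => (\1_(N m) w)%:E)) => i.
by rewrite lee_fin.
Qed.

Let delay w := tau w - nu.+1%:R%:E.

Let mtau : measurable_fun setT tau.
Proof. exact: measurable_cusum_time. Qed.

Let mdelay : measurable_fun setT delay.
Proof. by apply: emeasurable_funB. Qed.

Lemma delay_le_residual w : delay w <= residual w.
Proof.
rewrite /delay; have [r /andP[_ rn] ->] := cusum_time_residual w.
by rewrite leeBlDr// addeC leeD2l// lee_fin.
Qed.

Lemma delay_integrable : P.-integrable setT delay.
Proof.
apply/integrableP; split => //.
apply: (@le_lt_trans _ _ (\int[P]_w (residual w + nu.+1%:R%:E))).
  apply: ge0_le_integral => //.
  - exact: measurableT_comp.
  - by apply: emeasurable_funD => //; exact: measurable_cst.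
  move=> w _; rewrite /delay.
  have [r /andP[r0 rn] ->] := cusum_time_residual w.
  have := residual_ge0 w; case: (residual w) => [x| |//]; last first.
    by rewrite leey.
  rewrite lee_fin => x0; rewrite -!EFinD lee_fin ler_norml.
  by apply/andP; split; lra.
rewrite ge0_integralD// integral_cst// [X in _ * X]probability_setT mule1.
rewrite lte_add_pinfty ?ltry//.
apply: le_lt_trans (integral_residual_le _) _.
  by rewrite -[past _ _]/(@measurable _ (pastType X nu.+1)); exact: measurableT.
by rewrite [X in _ * X]probability_setT mule1 ltry.
Qed.

Lemma integral_delay_le B : past X nu.+1 B ->
  \int[P]_(w in B) delay w <= delay_bound%:E * P B.
Proof.
move=> pB; have mB := past_measurable pB.
apply: le_trans (integral_residual_le pB).
rewrite integralE.
apply: (@le_trans _ _ (\int[P]_(w in B) delay^\+ w)).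
  rewrite -[leRHS]sube0; apply: leeB => //.
  by apply: integral_ge0 => w _; exact: funeneg_ge0.
apply: ge0_le_integral => //.
- by apply: measurable_funTS; exact: measurable_funepos.
- exact: measurable_funTS.
move=> w _; rewrite funeposE ge_max residual_ge0 andbT.
exact: delay_le_residual.
Qed.

End detection_delay.

(** * Versions of conditional expectations *)

Section conditional_expectation.
Context d (Omega : measurableType d) (R : realType).
Variables (P : probability Omega R) (U : set (set Omega)).
Hypothesis Umeas : U `<=` measurable.
Variable Z : Omega -> \bar R.
Hypothesis intZ : P.-integrable setT Z.

Let subT := g_sigma_algebraType U.

Let sub_measurable (B : set Omega) : <<s U >> B -> measurable B.
Proof. by apply: smallest_sub => //; exact: sigma_algebra_measurable. Qed.

Let mid : measurable_fun [set: Omega] (idfun : Omega -> subT).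
Proof. by move=> _ B mB; rewrite setTI; exact: sub_measurable. Qed.

Let mid_ := isMeasurableFun.Build _ _ _ _ _ mid.
Let restr : {mfun Omega >-> subT} := HB.pack (idfun : Omega -> subT) mid_.

Let subcharge (B : set subT) : \bar R := induced_charge intZ B.

Let subcharge0 : subcharge set0 = 0.
Proof. exact: (charge0 (induced_charge intZ)). Qed.

Let subcharge_fin B : measurable B -> subcharge B \is a fin_num.
Proof.
by move=> /sub_measurable mB; exact: (fin_num_measure (induced_charge intZ)).
Qed.

Let subcharge_sigma_additive : semi_sigma_additive subcharge.
Proof.
move=> F mF tF mUF.
apply: (charge_semi_sigma_additive (s := induced_charge intZ)) => //.
  by move=> n; apply: sub_measurable; exact (mF n).
exact: sub_measurable.
Qed.

HB.instance Definition _ := isCharge.Build _ subT R subcharge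
  subcharge0 subcharge_fin subcharge_sigma_additive.

(** The density, on the sub-sigma-algebra, of the integral of Z with respect to
    the restriction of P. *)
Lemma cond_expectation_exists : exists Y, is_cond_expectation P <<s U >> Z Y.
Proof.
have dom : subcharge `<< distribution P restr.
  apply/null_content_dominatesP => B mB PB0.
  have mB' := sub_measurable mB.
  apply: (@null_set_integral _ _ _ P) => //.
  by apply: measurable_funTS; exact: measurable_int intZ.
pose Y := Radon_Nikodym subcharge (distribution P restr).
have intY := Radon_Nikodym_integrable dom.
have mY : measurable_fun [set: subT] Y by exact: measurable_int intY.
exists Y; split.
  by move=> B mB; have := mY measurableT B mB; rewrite setTI.
move=> B GB; transitivity (subcharge B); last by [].
rewrite (Radon_Nikodym_integral dom)// -/Y.
have intYP : P.-integrable B Y.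
  apply: (integrableS measurableT) => //; first exact: sub_measurable.
  apply/integrableP; split.
    by move=> _ C mC; rewrite setTI; apply: sub_measurable;
      have := mY measurableT C mC; rewrite setTI.
  have /integrableP[_] := intY.
  rewrite ge0_integral_pushforward//.
  exact: measurableT_comp.
by rewrite (integral_pushforward mid mY).
Qed.

End conditional_expectation.

Section version.
Context d (Omega : measurableType d) (R : realType).
Variables (P : probability Omega R) (G : set (set Omega)).
Hypothesis Gmeas : G `<=` measurable.

Lemma cond_expectationP (Z : Omega -> \bar R) :
  (exists Y, is_cond_expectation P G Z Y) ->
  is_cond_expectation P G Z (cond_expectation P G Z).
Proof. by move=> ex; exact: (xgetPex (cst 0) ex). Qed.

(** The integral of Y may be infinite, so the positive and negative parts are
    compared separately. *)
Lemma integral_le_ae_bound (Y : Omega -> \bar R) (B : set Omega) (r : R) :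
  measurable B -> measurable_fun setT Y -> (\forall w \ae P, Y w <= r%:E) ->
  \int[P]_(w in B) Y w <= r%:E * P B.
Proof.
move=> mB mY Yr.
have E1 : \int[P]_(w in B) Y^\+ w <= (Num.max r 0%R)%:E * P B.
  rewrite -integral_cst//; apply: ae_ge0_le_integral => //.
  - by apply: measurable_funTS; exact: measurable_funepos.
  - by move=> w _; rewrite lee_fin le_max lexx orbT.
  - apply: filterS Yr => w Yr _.
    by rewrite /= funeposE EFin_max ge_max !le_max Yr lexx orbT.
have E2 : (Num.max (- r) 0%R)%:E * P B <= \int[P]_(w in B) Y^\- w.
  rewrite -integral_cst//; apply: ae_ge0_le_integral => //.
  - by move=> w _; rewrite lee_fin le_max lexx orbT.
  - by apply: measurable_funTS; exact: measurable_funeneg.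
  - apply: filterS Yr => w Yr _.
    by rewrite /= funenegE EFin_max EFinN ge_max !le_max leeN2 Yr lexx orbT.
rewrite integralE; apply: le_trans (leeB E1 E2) _.
rewrite -(fineK (fin_num_measure P _ mB)) -!EFinM -EFinB lee_fin -mulrBl.
rewrite ler_wpM2r//; first exact: fine_ge0.
have [r0|/ltW r0] := leP 0%R r.
  by rewrite (@max_r _ _ (- r)%R) ?oppr_le0// subr0.
by rewrite (@max_l _ _ (- r)%R) ?oppr_ge0// opprK add0r.
Qed.

Lemma measurable_version Z Y : is_cond_expectation P G Z Y ->
  measurable_fun setT Y.
Proof. by move=> [GY _] _ B mB; rewrite setTI; exact/Gmeas/GY. Qed.

(** Test the bound on the event that the version exceeds K + e. *)
Lemma ess_sup_version_le Z Y (K : R) : (0 <= K)%R ->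
  is_cond_expectation P G Z Y ->
  (forall B, G B -> \int[P]_(w in B) Z w <= K%:E * P B) ->
  ess_sup P Y <= K%:E.
Proof.
move=> K0 YZ ZK; have mY := measurable_version YZ.
apply/lee_addgt0Pr => e e0; apply/ess_supP; apply/ae_le_measureP => //.
rewrite -EFinD; set B := Y @^-1` _.
have GB : G B by apply: YZ.1; exact: emeasurable_itv.
have mB := Gmeas GB.
have : (K + e)%:E * P B <= K%:E * P B.
  apply: le_trans (ZK B GB); rewrite -(YZ.2 B GB).
  rewrite -integral_cst//; apply: ge0_le_integral => //.
  - by move=> w _; rewrite lee_fin addr_ge0// ltW.
  - exact: measurable_funTS.
  - by move=> w; rewrite /B /= in_itv/= andbT => /ltW.
rewrite -(fineK (fin_num_measure P _ mB)) -!EFinM lee_fin.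
have p0 : (0 <= fine (P B))%R by exact: fine_ge0.
rewrite mulrDl -[leRHS]addr0 lerD2l pmulr_rle0// => p0'.
rewrite -[LHS](fineK (fin_num_measure P _ mB)).
by congr (_%:E); apply/eqP; rewrite eq_le p0' p0.
Qed.

Lemma cond_mean_event_le_ess_sup Z Y B : G B -> 0 < P B ->
  is_cond_expectation P G Z Y ->
  cond_mean_event P B Z <= ess_sup P Y.
Proof.
move=> GB PB YZ; have mY := measurable_version YZ.
have mB := Gmeas GB.
have PBfin : P B \is a fin_num by exact: fin_num_measure.
have p0 : (0 < fine (P B))%R by rewrite fine_gt0// PB ltey_eq PBfin.
have bound r : ess_sup P Y <= r%:E -> cond_mean_event P B Z <= r%:E.
  move=> /ess_supP Yr.
  rewrite /cond_mean_event -(YZ.2 B GB) -(fineK PBfin) inver gt_eqF//.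
  rewrite lee_pdivrMr// fineK//; exact: integral_le_ae_bound.
case eE : (ess_sup P Y) => [r| |].
- by apply: bound; rewrite eE ?leNye.
- by rewrite leey.
have {}bound r : cond_mean_event P B Z <= r%:E.
  by apply: bound; rewrite eE ?leNye.
case: (cond_mean_event P B Z) bound => [c bound|bound|//].
  by have := bound (c - 1)%R; rewrite lee_fin lerBrDr gerDl ler10.
by have := bound 0%R.
Qed.

End version.

(** * Worst-case delay *)

Section worst_delay.
Context d d' (Omega : measurableType d) (E : measurableType d').
Context (R : realType).
Variables (mu : {measure set E -> \bar R}) (T : nat) (f g : nat -> E -> R).
Variables (X : nat -> {mfun Omega >-> E}) (P : nat -> probability Omega R).
Hypothesis T0 : (0 < T)%N.
Hypothesis df : forall n, (1 <= n)%N -> is_density mu (f n).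
Hypothesis dg : forall n, (1 <= n)%N -> is_density mu (g n).
Hypothesis fT : forall n, (1 <= n)%N -> f (n + T)%N = f n.
Hypothesis gT : forall n, (1 <= n)%N -> g (n + T)%N = g n.
Hypothesis PX : forall nu, (1 <= nu)%N -> change_law (P nu) mu X f g nu.
Hypothesis Ifin : mean_divergence mu T f g < +oo.
Hypothesis I0 : 0 < mean_divergence mu T f g.

Let I := fine (mean_divergence mu T f g).

Let Ipos : (0 < I)%R.
Proof. by apply: fine_gt0; rewrite I0. Qed.

Lemma mean_drift_gt (J : R) : (J < I)%R ->
  exists2 M : R, (0 <= M)%R & (J < mean_drift mu T f g M)%R.
Proof.
move=> JI.
have /cvgr_gt/(_ _ JI)[n _ /(_ n (leqnn n)) H] := cvg_mean_drift T0 df dg Ifin.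
by exists n%:R.
Qed.

Let tau thr := cusum_time X f g thr.
Let delay thr nu w := tau thr w - nu%:R%:E.

(** The chosen version is a genuine one: the delay is integrable, since its
    mean is bounded for any cut with positive mean drift. *)
Lemma delay_cond_expectation thr nu : (1 <= nu)%N ->
  is_cond_expectation (P nu) (past X nu) (delay thr nu)
    (cond_expectation (P nu) (past X nu) (delay thr nu)).
Proof.
case: nu => // nu _; apply: cond_expectationP.
have [M M0 J0] := mean_drift_gt Ipos.
apply: cond_expectation_exists.
  move=> _ [i _ [C mC <-]]; apply: measurable_funPT => //; exact: mC.
have PXnu := PX (isT : (1 <= nu.+1)%N).
exact: (delay_integrable thr T0 df dg fT gT PXnu Ifin M0 J0).
Qed.

Lemma worst_average_delay_le thr M : (0 <= M)%R ->
  (0 < mean_drift mu T f g M)%R ->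
  worst_average_delay P X (tau thr) <= (delay_bound mu T f g thr M)%:E.
Proof.
move=> M0 J0; apply: ge_ereal_sup => _ [[|nu] //= nu1 <-].
apply: (ess_sup_version_le (Z := delay thr nu.+1)
  (@past_measurable _ _ _ _ X nu.+1)).
- exact: delay_bound_ge0.
- exact: delay_cond_expectation.
move=> B pB.
exact: (integral_delay_le thr T0 df dg fT gT (PX nu1) Ifin M0 J0 pB).
Qed.

Lemma cond_average_delay_le_worst thr :
  cond_average_delay P (tau thr) <= worst_average_delay P X (tau thr).
Proof.
apply: ge_ereal_sup => _ [nu [nu1 PB0] <-].
case: nu nu1 PB0 => // nu nu1 PB0.
apply: (@le_trans _ _ (ess_sup (P nu.+1)
    (cond_expectation (P nu.+1) (past X nu.+1) (delay thr nu.+1)))); last first.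
  by apply: ereal_sup_ubound; exists nu.+1.
apply: (cond_mean_event_le_ess_sup (@past_measurable _ _ _ _ X nu.+1)) => //.
  rewrite (_ : [set w | _] = no_alarm X f g thr nu).
    apply: past_no_alarm => // n n1.
    have [mf f0 _] := df n1; have [mg g0 _] := dg n1.
    exact: measurable_log_ratio.
  by apply/seteqP; split => w /no_alarmP.
exact: delay_cond_expectation.
Qed.

Lemma worst_average_delay_asymptotics :
  exists o1 : R -> R, o1 beta @[beta --> +oo%R] --> (0 : R)%R /\
     \forall beta \near +oo%R,
       worst_average_delay P X (tau (ln beta)) <=
         (ln beta / I * (1 + o1 beta))%:E.
Proof.
pose V beta := worst_average_delay P X (tau (ln beta)).
have Voo beta : V beta < +oo.
  have [M M0 J0] := mean_drift_gt Ipos.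
  apply: le_lt_trans (worst_average_delay_le (ln beta) M0 J0) _.
  by rewrite ltry.
have ln_ge (c : R) : \forall beta \near +oo%R, (c < ln beta)%R.
  apply: filterS (nbhs_pinfty_gt (num_real (expR c))) => beta cb.
  by rewrite -[ltLHS]expRK ltr_ln ?posrE ?expR_gt0// (lt_trans _ cb)// expR_gt0.
(* The smallest nonnegative error term for which the bound holds. *)
exists (fun beta => Num.max 0 (fine (V beta) * I / ln beta - 1))%R; split.
  apply/cvgrPdist_le => e e0.
  pose J := (I / (1 + e / 2))%R.
  have e2 : (0 < 1 + e / 2)%R by rewrite addr_gt0// divr_gt0.
  have JI : (J < I)%R.
    by rewrite ltr_pdivrMr// ltr_pMr// ltrDl divr_gt0.
  have J0 : (0 < J)%R by rewrite divr_gt0.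
  have [M M0 JM] := mean_drift_gt JI.
  have Jpos := lt_trans J0 JM.
  set J' := mean_drift mu T f g M in JM Jpos.
  pose C := (M + T%:R * (1 + J'))%R.
  near=> beta.
  have l0 : (0 < ln beta)%R by near: beta; exact: ln_ge.
  have lC : (C * (1 + e / 2) / (e / 2) < ln beta)%R by near: beta; exact: ln_ge.
  rewrite sub0r normrN ger0_norm ?le_max ?lexx//.
  rewrite ge_max (ltW e0) /= lerBlDr ler_pdivrMr// addrC.
  have C0 : (0 <= C)%R.
    by rewrite addr_ge0// mulr_ge0// addr_ge0// ltW.
  have fV : (fine (V beta) <= (ln beta + C) / J')%R.
    have := worst_average_delay_le (ln beta) M0 Jpos.
    rewrite -/(V beta) /delay_bound (@max_l _ _ (ln beta)) ?(ltW l0)//.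
    rewrite -addrA -/J' -/C.
    case: (V beta) (Voo beta) => [v _|//|_ _] /=; first by rewrite lee_fin.
    exact: divr_ge0 (addr_ge0 (ltW l0) C0) (ltW Jpos).
  apply: (@le_trans _ _ ((ln beta + C) / J' * I)%R).
    by rewrite ler_wpM2r// ltW.
  have H1 : ((ln beta + C) / J' * I <= (ln beta + C) * (1 + e / 2))%R.
    rewrite -mulrA; apply: ler_wpM2l; first exact: addr_ge0 (ltW l0) C0.
    rewrite ler_pdivrMl// -ler_pdivrMr//; exact: ltW.
  apply: (le_trans H1).
  have : (C * (1 + e / 2) < ln beta * (e / 2))%R.
    by rewrite -ltr_pdivrMr// divr_gt0.
  set L := ln beta => H2.
  have -> : ((L + C) * (1 + e / 2) =
      L + C * (1 + e / 2) + L * (e / 2))%R by ring.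
  have -> : ((1 + e) * L = L + L * (e / 2) + L * (e / 2))%R by field.
  by rewrite lerD2r lerD2l ltW.
near=> beta.
have l0 : (0 < ln beta)%R by near: beta; exact: ln_ge.
apply: (@le_trans _ _ (fine (V beta))%:E).
  rewrite -/(V beta); case: (V beta) (Voo beta) => //= _.
  by rewrite leNye.
rewrite lee_fin; set v := fine (V beta).
have vE : v = (ln beta / I * (v * I / ln beta))%R.
  by field; rewrite !gt_eqF.
rewrite [leLHS]vE; apply: ler_wpM2l; first by rewrite divr_ge0// ltW.
by rewrite -lerBlDl le_max lexx orbT.
Unshelve. all: by end_near. Qed.

End worst_delay.

Theorem theorem3p2 (R : realType) (d d' : measure_display)
    (Omega : measurableType d) (E : measurableType d')
    (mu : {sigma_finite_measure set E -> \bar R})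
    (T : nat) (f g : nat -> E -> R) (X : nat -> {mfun Omega >-> E})
    (Pinf : probability Omega R) (P : nat -> probability Omega R)
    (I : \bar R) :
  (1 <= T)%N ->
  (forall n, (1 <= n)%N -> is_density mu (f n)) ->
  (forall n, (1 <= n)%N -> is_density mu (g n)) ->
  (forall n, (1 <= n)%N -> f (n + T)%N = f n) ->
  (forall n, (1 <= n)%N -> g (n + T)%N = g n) ->
  no_change_law Pinf mu X f ->
  (forall nu, (1 <= nu)%N -> change_law (P nu) mu X f g nu) ->
  I = mean_divergence mu T f g ->
  0 < I -> I < +oo ->
  let tau (beta : R) := cusum_time X f g (ln beta) in
  (forall beta : R, (0 < beta)%R ->
     beta%:E <= \int[Pinf]_w tau beta w) /\
  (forall beta : R, (0 < beta)%R ->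
     cond_average_delay P (tau beta) <= worst_average_delay P X (tau beta)) /\
  (exists o1 : R -> R, o1 beta @[beta --> +oo%R] --> (0 : R)%R /\
     \forall beta \near +oo%R,
       worst_average_delay P X (tau beta) <=
         (ln beta / fine I * (1 + o1 beta))%:E).
Proof.
move=> T0 df dg fT gT PinfX PX -> I0 Ioo tau; split; [|split].
- by move=> beta beta0; exact: expected_cusum_time_ge PinfX beta0.
- move=> beta _.
  exact: (cond_average_delay_le_worst T0 df dg fT gT PX Ioo I0 (ln beta)).
- exact: (worst_average_delay_asymptotics T0 df dg fT gT PX Ioo I0).
Qed.
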